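(* Let $n \geq 2$ and let $z_1,\dots,z_n$ be the standard coordinates on $\mathbb{C}^n$. Consider the complete polynomial vector fields with polynomial flow $$U = \frac{\partial}{\partial z_n},$$ $$V' = \frac{\partial}{\partial z_n} + \sum_{k=2}^{n} \Big(\prod_{j=k+1}^{n} z_j^2\Big) z_k^5 \,\frac{\partial}{\partial z_{k-1}} = \frac{\partial}{\partial z_n} + z_n^5 \frac{\partial}{\partial z_{n-1}} + z_n^2 z_{n-1}^5 \frac{\partial}{\partial z_{n-2}} + \dots + z_n^2 z_{n-1}^2\cdots z_3^2 z_2^5 \frac{\partial}{\partial z_1},$$ $$V'' = \frac{\partial}{\partial z_1} + \sum_{k=2}^{n} \Big(\prod_{j=1}^{k-2} z_j^2\Big) z_{k-1}^5 \,\frac{\partial}{\partial z_k} = \frac{\partial}{\partial z_1} + z_1^5 \frac{\partial}{\partial z_2} + z_1^2 z_2^5 \frac{\partial}{\partial z_3} + \dots + z_1^2 z_2^2\cdots z_{n-2}^2 z_{n-1}^5 \frac{\partial}{\partial z_n}.$$ Then the group generated by the (algebraic) flows of $U$, $V'$ and $V''$, i.e. the group generated by the three unipotent one-parameter subgroups arising as flows of $U$, $V'$ and $V''$, acts infinitely transitively on $\mathbb{C}^n$.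
   Context: A holomorphic vector field is called complete if its flow map exists for all complex times. A unipotent one-parameter subgroup is the one-parameter group $\{\varphi_t : t \in \mathbb{C}\}$ of polynomial automorphisms given by a complete polynomial flow of a polynomial vector field, i.e. an algebraic action of the additive group $\mathbb{C}_+$ on $\mathbb{C}^n$, so that $(t,z)\mapsto\varphi_t(z)$ is polynomial. The group generated by the flows is the group generated by all time-$t$ maps, $t\in\mathbb{C}$. An action of a group $G$ on a complex manifold $X$ is infinitely transitive if it is $m$-transitive for every $m \in \mathbb{N}$, i.e. for any two $m$-tuples $(x_1,\dots,x_m)$ and $(y_1,\dots,y_m)$ of pairwise distinct points of $X$ there is $g \in G$ with $g x_i = y_i$ for all $i = 1,\dots,m$. Empty products equal $1$. *)

(* Defs.v *)
(* MathComp world (with MathComp-Analysis and multinomials). *)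
From HB Require Import structures.
From mathcomp Require Import all_boot all_order all_algebra.
(* Not imported: the notations of mpoly clash with those of the analysis
   library. *)
From mathcomp Require mpoly.
From mathcomp Require Import all_classical all_reals all_analysis.

Set Implicit Arguments.
Unset Strict Implicit.
Unset Printing Implicit Defensive.

Import Order.TTheory GRing.Theory Num.Theory.
Import numFieldNormedType.Exports.

Local Open Scope classical_set_scope.
Local Open Scope ring_scope.

Section GroupActions.
Variable X : Type.

(* The intended generators are bijections, so that [gen_inv], which adds the
   two-sided inverse of an element, closes the set under inversion. *)
Inductive generated_group (S : set (X -> X)) : set (X -> X) :=
| gen_base g : S g -> generated_group S g
| gen_id : generated_group S id
| gen_comp g h :
    generated_group S g -> generated_group S h -> generated_group S (g \o h)
| gen_inv g h :
    generated_group S g -> cancel g h -> cancel h g -> generated_group S h.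

Definition transitive_on_tuples (G : set (X -> X)) (m : nat) : Prop :=
  forall x y : 'I_m -> X, injective x -> injective y ->
    exists2 g, G g & forall i, g (x i) = y i.

Definition infinitely_transitive (G : set (X -> X)) : Prop :=
  forall m : nat, transitive_on_tuples G m.

End GroupActions.

(* C is to be instantiated with R[i] for R : realType. *)
Section Flows.
Variables (C : numFieldType) (n : nat).

(* The holomorphic tangent bundle of C^n being trivial, a vector field on C^n
   is given by its components in the frame d/dz_1, ..., d/dz_n. *)
Definition vector_field := 'rV[C]_n -> 'rV[C]_n.

(* The global flow, defined for all times t in C. The derivative in t is the
   complex one when C is R[i]: C^o is C as a normed space over itself. *)
Definition is_flow (V : vector_field) (phi : C -> 'rV[C]_n -> 'rV[C]_n) : Prop :=
  forall z : 'rV[C]_n,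
    phi 0 z = z /\
    forall (t : C) (i : 'I_n),
      is_derive (t : C^o) (1 : C^o) (fun s : C^o => phi s z ord0 i : C^o)
        (V (phi t z) ord0 i).

(* Joint polynomiality in (t, z): t is the variable of index 0 and z_1, ..., z_n
   are those of index 1, ..., n. *)
Definition algebraic (phi : C -> 'rV[C]_n -> 'rV[C]_n) : Prop :=
  exists P : 'I_n -> mpoly.mpoly (1 + n) C,
    forall (t : C) (z : 'rV[C]_n) (i : 'I_n),
      phi t z ord0 i =
      mpoly.meval (fun j : 'I_(1 + n) => row_mx (t%:M : 'M[C]_1) z ord0 j) (P i).

Definition unipotent_subgroup (phi : C -> 'rV[C]_n -> 'rV[C]_n) : Prop :=
  [/\ algebraic phi,
      forall z, phi 0 z = z &
      forall s t z, phi (s + t) z = phi s (phi t z)].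

Definition has_unipotent_flow (V : vector_field) : Prop :=
  exists2 phi, is_flow V phi & unipotent_subgroup phi.

Definition time_maps (V : vector_field) : set ('rV[C]_n -> 'rV[C]_n) :=
  [set f | exists phi t, is_flow V phi /\ f = phi t].

Definition flow_group (F : set vector_field) : set ('rV[C]_n -> 'rV[C]_n) :=
  generated_group (\bigcup_(V in F) time_maps V).

End Flows.

Section Fields.
Variables (C : numFieldType) (n : nat).

(* Coordinates z_k and frame vectors d/dz_k are numbered from 1 to n; outside
   this range they are junk values, which the fields below never use when
   2 <= n. *)
Definition zcoord (z : 'rV[C]_n) (k : nat) : C :=
  if insub k.-1 is Some i then z ord0 i else 0.

Definition partial (k : nat) : 'rV[C]_n := \row_(i < n) (i.+1 == k)%:R.

Definition fieldU : vector_field C n := fun=> partial n.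

Definition fieldV' : vector_field C n := fun z =>
  partial n +
  \sum_(2 <= k < n.+1)
     ((\prod_(k.+1 <= j < n.+1) zcoord z j ^+ 2) * zcoord z k ^+ 5)
       *: partial k.-1.

Definition fieldV'' : vector_field C n := fun z =>
  partial 1 +
  \sum_(2 <= k < n.+1)
     ((\prod_(1 <= j < k.-1) zcoord z j ^+ 2) * zcoord z k.-1 ^+ 5)
       *: partial k.

End Fields.

(* Main.v *)
(* The proof is algebraic. The velocities at time 0 of polynomial families of
   elements of the group G, through the identity, form a Lie algebra of
   polynomial vector fields: sums come from composition, brackets from
   conjugation. It contains U, V' and V'', and bracketing V' and V'' with
   constant fields extracts from them all the d/dz_k, the z_k d/dz_(k-1) and
   z_(k-1) d/dz_k, and z_n^2 d/dz_(n-1). These generate all Hamiltonian fields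
   in the variables z_(n-1), z_n, the other variables being parameters, and the
   resulting Lie algebra spans the tangent space of the configuration space at
   every m-tuple x of distinct points. Composing dim = m n such families gives
   a polynomial map C^dim -> C^dim with values in the orbit of x and invertible
   differential at 0. It is dominant, so its image, which is constructible by
   elimination of quantifiers, contains the complement of a hypersurface. Two
   such complements meet, hence so do any two orbits. *)
Require Import Defs.
From mathcomp Require Import all_boot all_order all_algebra.
From mathcomp Require Import closed_field complex ring.
From mathcomp Require mpoly boolp.

Set Implicit Arguments.
Unset Strict Implicit.
Unset Printing Implicit Defensive.

Import Order.TTheory GRing.Theory Num.Theory.

Local Open Scope ring_scope.

(* The notations of mpoly clash with those of the analysis library: they are
   confined to this module, and the analysis library is imported after it. *)
Module PolynomialFields.
Import mpoly.

(** * Substitution in multivariate polynomials *)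

Section Substitution.
Variables (K : numFieldType) (n : nat).
Implicit Types (p : {mpoly K[n]}).

Definition psub (c : 'I_n -> {poly K}) p : {poly K} := mmap polyC c p.

Definition msub l (q : 'I_n -> {mpoly K[l]}) p : {mpoly K[l]} :=
  mmap (@mpolyC l K) q p.

Lemma rmorph_mmap (S T : comNzRingType) (g : {rmorphism S -> T})
    (f : K -> S) (f' : K -> T) h p :
  (forall c, g (f c) = f' c) -> g (mmap f h p) = mmap f' (g \o h) p.
Proof.
move=> fE; rewrite /mmap rmorph_sum; apply: eq_bigr => m _.
rewrite rmorphM fE /mmap1 rmorph_prod; congr (_ * _).
by apply: eq_bigr => i _; rewrite rmorphXn.
Qed.

Lemma eq_mmap (S : nzRingType) (f : K -> S) h h' p :
  h =1 h' -> mmap f h p = mmap f h' p.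
Proof. by move=> hE; apply: eq_bigr => m _; rewrite (mmap1_eq _ hE). Qed.

Lemma mpoly_ring_ind (P : {mpoly K[n]} -> Prop) :
  (forall c, P c%:MP) -> (forall i, P 'X_i) ->
  (forall p q, P p -> P q -> P (p + q)) ->
  (forall p q, P p -> P q -> P (p * q)) -> forall p, P p.
Proof.
move=> PC PX PD PM p; elim/mpolyind: p => [|c m p _ _ IH].
  by rewrite -mpolyC0; apply: PC.
apply: PD => //; rewrite -mul_mpolyC; apply: (PM) => //.
rewrite mpolyXE_id; apply: (big_ind P); [by rewrite -mpolyC1 | exact: (PM) |].
move=> i _; elim: (m i) => [|k IHk]; first by rewrite expr0 -mpolyC1.
by rewrite exprS; apply: PM.
Qed.

Lemma horner_psub c p s : (psub c p).[s] = p.@[fun i => (c i).[s]].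
Proof.
rewrite -/(horner_eval s _) (@rmorph_mmap _ _ (horner_eval s) _ idfun) //.
by move=> a; rewrite /= /horner_eval hornerC.
Qed.

Lemma meval_msub l (q : 'I_n -> {mpoly K[l]}) p v :
  (msub q p).@[v] = p.@[fun i => (q i).@[v]].
Proof.
by rewrite (@rmorph_mmap _ _ (meval v) _ idfun) // => a; rewrite /= mevalC.
Qed.

Lemma msubC l (q : 'I_n -> {mpoly K[l]}) a : msub q a%:MP = a%:MP.
Proof. exact: mmapC. Qed.
Lemma msubX l (q : 'I_n -> {mpoly K[l]}) i : msub q 'X_i = q i.
Proof. by rewrite /msub mmapX mmap1U. Qed.
Lemma msubD l (q : 'I_n -> {mpoly K[l]}) : {morph msub q : p1 p2 / p1 + p2}.
Proof. exact: mmapD. Qed.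
Lemma msubM l (q : 'I_n -> {mpoly K[l]}) : {morph msub q : p1 p2 / p1 * p2}.
Proof. by move=> p1 p2; rewrite /msub rmorphM. Qed.
Lemma psubC c a : psub c a%:MP = a%:P.
Proof. exact: mmapC. Qed.
Lemma psubX c i : psub c 'X_i = c i.
Proof. by rewrite /psub mmapX mmap1U. Qed.
Lemma psubD c : {morph psub c : p1 p2 / p1 + p2}.
Proof. exact: mmapD. Qed.
Lemma psubM c : {morph psub c : p1 p2 / p1 * p2}.
Proof. by move=> p1 p2; rewrite /psub rmorphM. Qed.

Lemma eq_msub l (q q' : 'I_n -> {mpoly K[l]}) p : q =1 q' -> msub q p = msub q' p.
Proof. exact: eq_mmap. Qed.

Lemma mderivXU (i j : 'I_n) : ('X_j : {mpoly K[n]})^`M(i) = (i == j)%:R%:MP.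
Proof.
rewrite mderivX mnm1E eq_sym; case: eqP => [->|_]; last by rewrite scale0r mpolyC0.
rewrite -[X in 'X_[X]](_ : 0%MM = _) ?mpolyX0 ?scale1r ?mpolyC1 //.
by apply/mnmP => k; rewrite mnmBE subnn mnm0E.
Qed.

Lemma mderiv_msub l (q : 'I_n -> {mpoly K[l]}) p i :
  (msub q p)^`M(i) = \sum_j msub q p^`M(j) * (q j)^`M(i).
Proof.
elim/mpoly_ring_ind: p => [a|j|p r IHp IHr|p r IHp IHr].
- rewrite msubC mderivC big1 // => j _.
  by rewrite mderivC -mpolyC0 msubC mpolyC0 mul0r.
- rewrite msubX (bigD1 j) //= mderivXU eqxx msubC mul1r big1 ?addr0 // => k ne.
  by rewrite mderivXU (negbTE ne) msubC mpolyC0 mul0r.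
- rewrite msubD mderivD IHp IHr -big_split; apply: eq_bigr => j _.
  by rewrite mderivD msubD mulrDl.
- rewrite msubM mderivM IHp IHr mulr_suml mulr_sumr -big_split.
  apply: eq_bigr => j _; rewrite mderivM msubD !msubM mulrDl; congr (_ + _).
    by rewrite mulrAC.
  by rewrite mulrA.
Qed.

Lemma deriv_psub c p :
  (psub c p)^`() = \sum_j psub c p^`M(j) * (c j)^`().
Proof.
elim/mpoly_ring_ind: p => [a|i|p q IHp IHq|p q IHp IHq].
- rewrite psubC derivC big1 // => j _.
  by rewrite mderivC -mpolyC0 psubC mul0r.
- rewrite psubX (bigD1 i) //= mderivXU eqxx psubC mul1r big1 ?addr0 // => j ne.
  by rewrite mderivXU (negbTE ne) psubC mul0r.
- rewrite psubD derivD IHp IHq -big_split; apply: eq_bigr => j _.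
  by rewrite mderivD psubD mulrDl.
- rewrite psubM derivM IHp IHq mulr_suml mulr_sumr -big_split.
  apply: eq_bigr => j _; rewrite mderivM psubD !psubM mulrDl; congr (_ + _).
    by rewrite mulrAC.
  by rewrite mulrA.
Qed.

Definition vel (q : {poly K}) : K := q^`().[0].

Lemma vel_psub c p :
  vel (psub c p) = \sum_j p^`M(j).@[fun i => (c i).[0]] * vel (c j).
Proof.
rewrite /vel deriv_psub horner_sum; apply: eq_bigr => j _.
by rewrite hornerM horner_psub.
Qed.

(** In characteristic 0 the integers are pairwise distinct in [K]; they would give a nonzero
    difference more roots than its size allows. *)
Lemma poly_fun_inj (p q : {poly K}) : (forall s, p.[s] = q.[s]) -> p = q.
Proof.
move=> pq; apply/eqP; rewrite -subr_eq0; apply/negPn/negP => nz.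
pose s := [seq (i%:R : K) | i <- iota 0 (size (p - q))].
have := @max_poly_roots _ (p - q) s nz.
rewrite size_map size_iota ltnn => H; suff: false by [].
apply: H; last first.
  by rewrite map_inj_uniq ?iota_uniq //; apply: mulrIn; rewrite oner_eq0.
by apply/allP => x _; rewrite /root hornerD hornerN pq subrr.
Qed.

Lemma vel_line p (v : 'I_n -> K) i :
  vel (psub (fun j => (v j)%:P + (j == i)%:R *: 'X) p) = p^`M(i).@[v].
Proof.
rewrite vel_psub (bigD1 i) //= big1 => [|j ne]; last first.
  by rewrite /vel derivD derivC derivZ derivX (negbTE ne) scale0r addr0 horner0 mulr0.
rewrite /vel derivD derivC derivZ derivX eqxx scale1r add0r hornerC mulr1 addr0.
by apply: meval_eq => j; rewrite hornerD hornerC hornerZ hornerX mulr0 addr0.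
Qed.

(** By [vel_line] a partial derivative is a velocity along a coordinate line, so it depends only on
    the values of the polynomial. *)
Lemma mderiv_fun_eq p q :
  (forall v, p.@[v] = q.@[v]) -> forall i v, p^`M(i).@[v] = q^`M(i).@[v].
Proof.
move=> pq i v; rewrite -!vel_line; congr vel; apply: poly_fun_inj => s.
by rewrite !horner_psub.
Qed.

Lemma msize_mderiv p k i : (msize p <= k.+1)%N -> (msize p^`M(i) <= k)%N.
Proof.
move=> pk; rewrite msizeE; apply/bigmax_leqP_seq => m mp _.
have: (m + U_(i))%MM \in msupp p.
  rewrite mcoeff_msupp; move: mp; rewrite mcoeff_msupp mcoeff_mderiv.
  by apply: contraNneq => ->; rewrite mul0rn.
by move=> /msize_mdeg_lt; rewrite mdegD mdeg1 addn1 => /leq_trans /(_ pk).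
Qed.

(** A monomial [m] with [m i != 0] would leave [m i] times its coefficient in the [i]-th derivative,
    and [m i] is nonzero in [K]. *)
Lemma mderiv0_const p : (forall i, p^`M(i) = 0) -> p = (p@_0%MM)%:MP.
Proof.
move=> dp; apply/mpolyP => m; rewrite mcoeffC.
have [->|nz] := eqVneq m 0%MM; first by rewrite mulr1.
have [i mi] : exists i, m i != 0%N.
  apply/existsP; apply: contraNT nz; rewrite negb_exists => /forallP m0.
  by apply/eqP/mnmP => i; rewrite mnm0E; apply/eqP; move: (m0 i); rewrite negbK.
have /(congr1 (mcoeff (m - U_(i))%MM)) := dp i.
rewrite mcoeff_mderiv mcoeff0 submK; last by rewrite lep1mP.
by move/eqP; rewrite mulrn_eq0 /= => /eqP ->; rewrite mulr0.
Qed.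

(** Induction on the degree: the partial derivatives vanish as functions by [mderiv_fun_eq], hence
    as polynomials, so [p] is constant. *)
Lemma mpoly_fun0 p : (forall v, p.@[v] = 0) -> p = 0.
Proof.
have [k pk] := ubnP (msize p); elim: k p pk => // k IH p pk p0.
have dp0 i : p^`M(i) = 0.
  case: k IH pk => [|k] IH pk; last first.
    apply: IH; first exact: msize_mderiv.
    move=> v; rewrite (@mderiv_fun_eq p 0) ?mderiv0 ?meval0 // => w.
    by rewrite meval0.
  have /eqP : msize p = 0%N by case: (msize p) pk.
  by rewrite msize_poly_eq0 => /eqP ->; rewrite mderiv0.
have := p0 (fun=> 0).
by rewrite (mderiv0_const dp0) mevalC => ->; rewrite mpolyC0.
Qed.

End Substitution.

Lemma msub_msub (K : numFieldType) n l r (c : 'I_l -> {mpoly K[r]})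
    (q : 'I_n -> {mpoly K[l]}) p :
  msub c (msub q p) = msub (fun i => msub c (q i)) p.
Proof.
rewrite /msub (@rmorph_mmap _ _ _ _ (mmap (@mpolyC r K) c) _ (@mpolyC r K)) //.
exact: mmapC.
Qed.

Lemma msub_id (K : numFieldType) n (p : {mpoly K[n]}) : msub (fun i => 'X_i) p = p.
Proof.
by elim/mpoly_ring_ind: p => [a|i|p q IHp IHq|p q IHp IHq];
  rewrite ?msubC ?msubX ?msubD ?msubM ?IHp ?IHq.
Qed.

Lemma psub_msub (K : numFieldType) n l (c : 'I_l -> {poly K})
    (q : 'I_n -> {mpoly K[l]}) p :
  psub c (msub q p) = psub (fun i => psub c (q i)) p.
Proof.
rewrite /psub /msub (@rmorph_mmap _ _ _ _ (mmap polyC c) _ polyC) //.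
exact: mmapC.
Qed.

(** * Images of dominant polynomial maps *)

Section Dominant.
Variable K : numFieldType.

(** Descent on the degree of an algebraic relation [Q] between the [F j]. By the chain rule the
    Jacobian matrix kills the vector of the [msub F Q^]M(j)[. Multiplying by the adjugate shows that
    each]Q^[M(j)] is again a relation, of smaller degree, hence zero; so [Q] is constant, and then
    zero. *)
Lemma dominant_inj N M (F : 'I_N -> {mpoly K[M]}) (G : 'I_N -> 'I_M) :
  \det (\matrix_(i, j < N) (F j)^`M(G i)) != 0 ->
  forall Q, msub F Q = 0 -> Q = 0.
Proof.
move=> dF Q; have [k Qk] := ubnP (msize Q); elim: k Q Qk => // k IH Q Qk Q0.
suff dQ i : Q^`M(i) = 0.
  move: Q0; rewrite (mderiv0_const dQ) msubC => /eqP.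
  by rewrite mpolyC_eq0 => /eqP ->; rewrite mpolyC0.
have [Q00|nzQ] := eqVneq Q 0; first by rewrite Q00 mderiv0.
case: k IH Qk => [|k] IH Qk.
  by move: Qk; rewrite ltnS leqn0 msize_poly_eq0 (negbTE nzQ).
apply: IH; first exact: msize_mderiv.
pose J := \matrix_(i, j < N) (F j)^`M(G i).
pose w := \col_j msub F Q^`M(j).
suff /colP/(_ i) : w = 0 by rewrite !mxE.
suff Jw : J *m w = 0.
  have : \adj J *m (J *m w) = 0 by rewrite Jw mulmx0.
  rewrite mulmxA mul_adj_mx mul_scalar_mx => /eqP.
  by rewrite scalemx_eq0 (negbTE dF) => /eqP.
apply/colP => l; rewrite !mxE.
have := mderiv_msub F Q (G l); rewrite Q0 mderiv0 => E; rewrite [RHS]E.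
by apply: eq_bigr => j _; rewrite !mxE mulrC.
Qed.
End Dominant.

(** * Images of polynomial maps by quantifier elimination *)

Section Chevalley.
Variables (K : numClosedFieldType) (N : nat).

(** The shift by [N] reserves the first [N] variables of the formulas for the coordinates of the
    target. *)
Lemma term_of_mpoly M (p : {mpoly K[M]}) :
  exists2 t : GRing.term K, GRing.rterm t &
    forall e, GRing.eval e t = p.@[fun i : 'I_M => e`_(N + i)].
Proof.
elim/mpoly_ring_ind: p => [a|i|p q [t rt tE] [u ru uE]|p q [t rt tE] [u ru uE]].
- by exists (GRing.Const a) => // e; rewrite mevalC.
- by exists (GRing.Var _ (N + i)) => // e; rewrite mevalXU.
- by exists (GRing.Add t u) => [|e] /=; rewrite ?rt // tE uE mevalD.
- by exists (GRing.Mul t u) => [|e] /=; rewrite ?rt // tE uE mevalM.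
Qed.

(** In an environment of size at most [N], the variables of index [N] and above take the default
    value 0, so they are replaced by 0. *)
Lemma mpoly_of_term (t : GRing.term K) : GRing.rterm t ->
  exists p : {mpoly K[N]}, forall e, (size e <= N)%N ->
    GRing.eval e t = p.@[fun i => e`_i].
Proof.
elim: t => [j|a|j|t IHt u IHu|t IHt|t IHt j|t IHt u IHu|t IHt|t IHt j] //=.
- move=> _; have [jN|Nj] := ltnP j N.
    by exists 'X_(Ordinal jN) => e _; rewrite mevalXU.
  exists 0 => e eN; rewrite meval0 nth_default //; exact: leq_trans Nj.
- by move=> _; exists a%:MP => e _; rewrite mevalC.
- by move=> _; exists j%:R%:MP => e _; rewrite mevalC.
- by case/andP=> /IHt[p pE] /IHu[q qE]; exists (p + q) => e eN; rewrite pE ?qE ?mevalD.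
- by move=> /IHt[p pE]; exists (- p) => e eN; rewrite pE ?mevalN.
- by move=> /IHt[p pE]; exists (p *+ j) => e eN; rewrite pE ?mevalMn.
- by case/andP=> /IHt[p pE] /IHu[q qE]; exists (p * q) => e eN; rewrite pE ?qE ?mevalM.
- by move=> /IHt[p pE]; exists (p ^+ j) => e eN; rewrite pE ?rmorphXn.
Qed.

(* A set described without quantifiers is generically full or generically
   empty: products of the witnesses serve for the Boolean combinations. *)
Lemma qf_generic (f : GRing.formula K) : GRing.qf_form f && GRing.rformula f ->
  exists b : bool, exists2 h : {mpoly K[N]}, h != 0 &
    forall e, (size e <= N)%N -> h.@[fun i => e`_i] != 0 ->
      GRing.qf_eval e f = b.
Proof.
elim: f => [b|t u|t|f IHf g IHg|f IHf g IHg|f IHf g IHg|f IHf|i f|i f] //=.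
- by move=> _; exists b, 1; rewrite ?oner_eq0.
- case/andP=> /mpoly_of_term[p pE] /mpoly_of_term[q qE].
  have [pq|npq] := eqVneq p q.
    by exists true, 1; rewrite ?oner_eq0 // => e eN _; rewrite pE ?qE // pq eqxx.
  exists false, (p - q); rewrite ?subr_eq0 // => e eN; rewrite mevalB subr_eq0.
  by rewrite pE ?qE // => /negbTE.
- rewrite andbACA => /andP[/IHf[b [h h0 hf]] /IHg[c [k k0 kg]]].
  exists (b && c), (h * k); first by rewrite mulf_neq0.
  by move=> e eN; rewrite mevalM mulf_eq0 negb_or => /andP[/hf-> // /kg->].
- rewrite andbACA => /andP[/IHf[b [h h0 hf]] /IHg[c [k k0 kg]]].
  exists (b || c), (h * k); first by rewrite mulf_neq0.
  by move=> e eN; rewrite mevalM mulf_eq0 negb_or => /andP[/hf-> // /kg->].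
- rewrite andbACA => /andP[/IHf[b [h h0 hf]] /IHg[c [k k0 kg]]].
  exists (b ==> c), (h * k); first by rewrite mulf_neq0.
  by move=> e eN; rewrite mevalM mulf_eq0 negb_or => /andP[/hf-> // /kg->].
- move=> /IHf[b [h h0 hf]]; exists (~~ b), h => // e eN /hf -> //.
Qed.

(** Quantifier elimination describes the image by a formula that has a constant truth value [b]
    where [h] does not vanish. If [b] were false, [h] would vanish on the whole image, that is
    [msub F h = 0], against dominance. *)
Lemma dominant_image M (F : 'I_N -> {mpoly K[M]}) :
  (forall Q, msub F Q = 0 -> Q = 0) ->
  exists2 h : {mpoly K[N]}, h != 0 &
    forall y : 'I_N -> K, h.@[y] != 0 -> exists v, forall r, (F r).@[v] = y r.
Proof.
move=> domF.
have /fin_all_exists2[t rt tE] r := term_of_mpoly (F r).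
(* The system [y r = F r (v)], with [y] in the variables below [N] and [v] in the next [M], which
   [g] binds existentially. *)
pose eqs := [seq GRing.Equal (GRing.Var K (nat_of_ord r)) (t r) | r <- enum 'I_N].
pose f := foldr GRing.And (GRing.Bool true) eqs.
pose g := foldr (@GRing.Exists K) f (iota N M).
have holds_f e : GRing.holds e f <-> forall r : 'I_N, e`_r = (F r).@[fun i => e`_(N + i)].
  rewrite /f /eqs; split=> [|H].
    suff: forall s : seq 'I_N, GRing.holds e (foldr GRing.And (GRing.Bool true)
      [seq GRing.Equal (GRing.Var K (nat_of_ord r)) (t r) | r <- s]) ->
      forall r : 'I_N, r \in s -> e`_r = (F r).@[fun i => e`_(N + i)].
      by move=> H /H{}H r; apply: H; rewrite mem_enum.
    elim=> //= r s IH [er /IH es] r'; rewrite inE => /predU1P[->|/es//].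
    by rewrite er tE.
  by elim: (enum _) => //= r s IH; split; rewrite // tE H.
have rg : GRing.rformula g.
  rewrite /g; elim: (iota _ _) => //=; rewrite /f /eqs.
  by elim: (enum _) => //= r s ->; rewrite rt.
have closedK : GRing.closed_field_axiom K := @solve_monicpoly K.
have wf := @ClosedFieldQE.wf_ex_elim K.
have ok := ClosedFieldQE.holds_ex_elim closedK.
have [b [h h0 hb]] := qf_generic (GRing.quantifier_elim_wf wf rg).
have genP (y : 'I_N -> K) : h.@[y] != 0 ->
    b <-> exists v, forall r, (F r).@[v] = y r.
  move=> hy; pose e := [seq y r | r <- enum 'I_N].
  have eE (r : 'I_N) : e`_r = y r.
    by rewrite (nth_map r) ?size_enum_ord // nth_ord_enum.
  rewrite -(hb e); [|by rewrite size_map size_enum_ord|by rewrite (meval_eq _ eE)].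
  split.
    move/(GRing.quantifier_elim_rformP wf ok e rg)/GRing.foldExistsP.
    move=> [e' ee' /holds_f fe']; exists (fun i => e'`_(N + i)) => r.
    by rewrite -fe' -ee' ?eE // !inE mem_iota leqNgt ltn_ord.
  move=> [v vE]; apply/(GRing.quantifier_elim_rformP wf ok e rg).
  apply/GRing.foldExistsP; exists (e ++ [seq v i | i <- enum 'I_M]).
    move=> j; rewrite !inE mem_iota nth_cat size_map size_enum_ord.
    have [jN _|Nj /=] := ltnP j N; first by [].
    rewrite -leqNgt => jM.
    have Mj : (M <= j - N)%N by rewrite leq_subRL.
    by rewrite !nth_default // size_map size_enum_ord.
  apply/holds_f => r; rewrite nth_cat size_map size_enum_ord ltn_ord eE -vE.
  apply: meval_eq => i; rewrite nth_cat size_map size_enum_ord.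
  rewrite ltnNge leq_addr /= addKn (nth_map i) ?size_enum_ord //.
  by rewrite nth_ord_enum.
exists h => // y hy; apply/genP => //.
apply: contraT => /negP nb; case/negP: h0; apply/eqP/domF/mpoly_fun0 => v.
rewrite meval_msub; apply/eqP/negPn/negP => hv; apply: nb.
by apply/genP; [exact: hv | exists v].
Qed.
End Chevalley.

(** * Velocities of polynomial families *)

Lemma coef1_size2 (A : comNzRingType) (q : {poly A}) :
  (size q <= 2)%N -> q`_1 = q.[1] - q.[0].
Proof.
move=> q2; rewrite !(horner_coef_wide _ q2) !big_ord_recl !big_ord0 /=.
by rewrite !expr0 !expr1 mulr0 !mulr1 !addr0 addrC addKr.
Qed.

(** The factor [2 ^+ r - 2 ^+ d] vanishes at [r = d], so the combination on the right has lost its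
    top coefficient. *)
Lemma horner_dilate (A : comNzRingType) d (q : {poly A}) t :
  (size q <= d.+1)%N ->
  (\poly_(r < d) ((2 ^+ r - 2 ^+ d) * q`_r)).[t] = q.[2 * t] - 2 ^+ d * q.[t].
Proof.
move=> qd; rewrite horner_poly !(horner_coef_wide _ qd).
rewrite mulr_sumr -sumrB [RHS]big_ord_recr /= exprMn.
rewrite [X in _ = _ + X](_ : _ = 0) ?addr0; last by ring.
by apply: eq_bigr => r _; rewrite exprMn; ring.
Qed.

Section Families.
Variables (K : numFieldType) (n : nat).
Local Notation time := (lshift n (ord0 : 'I_1)).
Local Notation space i := (rshift 1 i).
Local Notation vars := (fun i : 'I_n => 'X_i : {mpoly K[n]}).

(** The target type is arbitrary, so that the same function serves for points [(t, z)] and for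
    substitutions of polynomials. *)
Definition pt (S : Type) (a : S) (c : 'I_n -> S) (j : 'I_(1 + n)) : S :=
  match split j with inl _ => a | inr i => c i end.

Lemma pt_time S (a : S) c : pt a c time = a.
Proof. by rewrite /pt (unsplitK (inl _)). Qed.

Lemma pt_space S (a : S) c i : pt a c (space i) = c i.
Proof. by rewrite /pt (unsplitK (inr _)). Qed.

Definition ptE := (pt_time, pt_space).

Lemma pt_ind (P : 'I_(1 + n) -> Prop) :
  P time -> (forall i, P (space i)) -> forall j, P j.
Proof. by move=> P0 P1 j; case: (split_ordP j) => i -> //; rewrite ord1. Qed.

Lemma sum_pt (V : nmodType) (f : 'I_(1 + n) -> V) :
  \sum_j f j = f time + \sum_i f (space i).
Proof. by rewrite big_split_ord big_ord1. Qed.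

Definition freeze (t : K) : {mpoly K[1 + n]} -> {mpoly K[n]} :=
  msub (pt t%:MP vars).

Definition flow (P : 'I_n -> {mpoly K[1 + n]}) (t : K) (z : 'rV[K]_n) : 'rV[K]_n :=
  \row_i (P i).@[pt t (z ord0)].

Definition pmap (g : 'I_n -> {mpoly K[n]}) (z : 'rV[K]_n) : 'rV[K]_n :=
  \row_i (g i).@[z ord0].

Lemma meval_freeze t p v : (freeze t p).@[v] = p.@[pt t v].
Proof.
rewrite meval_msub; apply: meval_eq; apply: pt_ind => [|i].
  by rewrite !ptE mevalC.
by rewrite !ptE mevalXU.
Qed.

Lemma pmap_freeze P t : pmap (fun i => freeze t (P i)) =1 flow P t.
Proof. by move=> z; apply/rowP => i; rewrite !mxE meval_freeze. Qed.

Lemma freeze_time t : freeze t 'X_time = t%:MP.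
Proof. by rewrite /freeze msubX ptE. Qed.

Lemma freeze_space t i : freeze t 'X_(space i) = 'X_i.
Proof. by rewrite /freeze msubX ptE. Qed.

Lemma msub_freeze l (q : 'I_n -> {mpoly K[l]}) t p :
  msub q (freeze t p) = msub (pt t%:MP q) p.
Proof.
rewrite msub_msub; apply: eq_msub; apply: pt_ind => [|i].
  by rewrite !ptE msubC.
by rewrite !ptE msubX.
Qed.

Lemma mderiv_freeze t p i : (freeze t p)^`M(i) = freeze t p^`M(space i).
Proof.
rewrite mderiv_msub sum_pt !ptE mderivC mulr0 add0r (bigD1 i) //= big1.
  by rewrite ptE mderivXU eqxx mulr1 addr0.
by move=> j ne; rewrite ptE mderivXU eq_sym (negbTE ne) mulr0.
Qed.

Lemma mderiv_space_time i : ('X_(space i) : {mpoly K[1 + n]})^`M(time) = 0.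
Proof. by rewrite mderivXU eq_lrshift mpolyC0. Qed.

Lemma mpoly_fun_inj m (p q : {mpoly K[m]}) : (forall v, p.@[v] = q.@[v]) -> p = q.
Proof.
move=> pq; apply/eqP; rewrite -subr_eq0; apply/eqP/mpoly_fun0 => v.
by rewrite mevalB pq subrr.
Qed.

Lemma flow0_freeze P : (forall z, flow P 0 z = z) ->
  forall i, freeze 0 (P i) = 'X_i.
Proof.
move=> P0 i; apply: mpoly_fun_inj => v; rewrite meval_freeze mevalXU.
have /rowP/(_ i) := P0 (\row_j v j); rewrite !mxE => <-.
apply: meval_eq; apply: pt_ind => [|j]; by rewrite !ptE ?mxE.
Qed.

Lemma mderiv_freeze0 P i j : freeze 0 (P i) = 'X_i ->
  freeze 0 (P i)^`M(space j) = (j == i)%:R%:MP.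
Proof. by move=> P0; rewrite -mderiv_freeze P0 mderivXU. Qed.

End Families.

Notation time := (lshift _ (ord0 : 'I_1)).
Notation space i := (rshift 1 i).

(** * The Lie algebra of tangent fields *)

Section Tangent.
Variables (K : numFieldType) (n : nat).
Variable G : ('rV[K]_n -> 'rV[K]_n) -> Prop.
Hypothesis G_ext : forall g h, g =1 h -> G g -> G h.
Hypothesis G_comp : forall g h, G g -> G h -> G (g \o h).
Hypothesis G_inv : forall g h, G g -> cancel g h -> cancel h g -> G h.
Local Notation vars := (fun i : 'I_n => 'X_i : {mpoly K[n]}).
Local Notation field := ('rV[{mpoly K[n]}]_n).

(* [Y] is the velocity at time 0 of a polynomial family in [G] through the
   identity. The family need not be a group, which makes the sum of two tangent
   fields tangent; the inverse family must be polynomial too, so that the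
   family can be used to conjugate others. *)
Definition tangent (Y : field) : Prop :=
  exists P Q : 'I_n -> {mpoly K[1 + n]},
  [/\ forall t, G (flow P t),
      forall t, cancel (flow P t) (flow Q t),
      forall t, cancel (flow Q t) (flow P t),
      forall z, flow P 0 z = z
    & forall i, freeze 0 (P i)^`M(time) = Y ord0 i].

Definition bracket (Z Y : field) : field :=
  \row_i \sum_l (Z ord0 l * (Y ord0 i)^`M(l) - Y ord0 l * (Z ord0 i)^`M(l)).

Lemma freezeM t : {morph @freeze K n t : p q / p * q}.
Proof. exact: msubM. Qed.
Lemma freezeD t : {morph @freeze K n t : p q / p + q}.
Proof. exact: msubD. Qed.
Lemma freezeC t a : @freeze K n t a%:MP = a%:MP.
Proof. exact: msubC. Qed.
Lemma freeze_sum t I (r : seq I) F :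
  @freeze K n t (\sum_(i <- r) F i) = \sum_(i <- r) freeze t (F i).
Proof. exact: raddf_sum. Qed.

Lemma flow_comp (P P' : 'I_n -> {mpoly K[1 + n]}) t :
  flow (fun i => msub (pt 'X_time P') (P i)) t =1 flow P t \o flow P' t.
Proof.
move=> z; apply/rowP => i; rewrite !mxE meval_msub; apply: meval_eq.
by apply: pt_ind => [|j]; rewrite !ptE ?mxE ?mevalXU ?ptE.
Qed.

(** Both families are the identity at time 0, so by the chain rule the velocities of a composite add
    up there. *)
Lemma tangentD Y Z : tangent Y -> tangent Z -> tangent (Y + Z).
Proof.
move=> [P [Q [GP PQ QP P0 PY]]] [P' [Q' [GP' PQ' QP' P0' PZ]]].
exists (fun i => msub (pt 'X_time P') (P i)), (fun i => msub (pt 'X_time Q) (Q' i)).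
split=> [t|t z|t z|z|i].
- by apply: G_ext (G_comp (GP t) (GP' t)) => z; rewrite flow_comp.
- by rewrite !flow_comp /= PQ PQ'.
- by rewrite !flow_comp /= QP' QP.
- by rewrite flow_comp /= P0' P0.
have P0i := flow0_freeze P0; have P0i' := flow0_freeze P0'.
have fE p : freeze 0 (msub (pt 'X_time P') p) = freeze 0 p.
  rewrite /freeze msub_msub; apply: eq_msub.
  by apply: pt_ind => [|j]; rewrite !ptE ?msubX ?ptE // -[LHS]/(freeze 0 _).
rewrite mderiv_msub sum_pt freezeD freeze_sum !mxE -PY -PZ; congr (_ + _).
  by rewrite freezeM fE ptE mderivXU eqxx freezeC mulr1.
rewrite (bigD1 i) //= big1 => [|j ne].
  by rewrite addr0 freezeM fE (mderiv_freeze0 _ (P0i i)) eqxx mul1r ptE.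
by rewrite freezeM fE (mderiv_freeze0 _ (P0i i)) (negbTE ne) mul0r.
Qed.

(** Reparametrize time by [t |-> c * t]. *)
Lemma tangentZ c Y : tangent Y -> tangent (c%:MP *: Y).
Proof.
move=> [P [Q [GP PQ QP P0 PY]]].
pose sc := pt (c%:MP * 'X_time) (fun i : 'I_n => 'X_(space i) : {mpoly K[1 + n]}).
have flow_sc (R : 'I_n -> {mpoly K[1 + n]}) t :
    flow (fun i => msub sc (R i)) t =1 flow R (c * t).
  move=> z; apply/rowP => i; rewrite !mxE meval_msub; apply: meval_eq.
  by apply: pt_ind => [|j]; rewrite /sc !ptE ?mevalM ?mevalC !mevalXU !ptE.
exists (fun i => msub sc (P i)), (fun i => msub sc (Q i)).
split=> [t|t z|t z|z|i].
- by apply: G_ext (GP (c * t)) => z; rewrite flow_sc.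
- by rewrite !flow_sc PQ.
- by rewrite !flow_sc QP.
- by rewrite flow_sc mulr0 P0.
have fE p : freeze 0 (msub sc p) = freeze 0 p.
  rewrite /freeze msub_msub; apply: eq_msub.
  apply: pt_ind => [|j]; rewrite /sc !ptE ?msubM ?msubC !msubX !ptE //.
  by rewrite mpolyC0 mulr0.
rewrite mderiv_msub sum_pt freezeD freeze_sum big1 => [|j _].
  rewrite addr0 freezeM fE PY /sc ptE mderiv_mulC mderivXU eqxx mulr1 freezeC.
  by rewrite mulrC mxE.
by rewrite /sc ptE mderiv_space_time freezeM -mpolyC0 freezeC mpolyC0 mulr0.
Qed.

(** The new field is the velocity of the conjugate family [g' \o P_t \o g], the inverse of [g] being
    [g']. *)
Lemma tangent_conj (g g' : 'I_n -> {mpoly K[n]}) Y :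
  G (pmap g) -> cancel (pmap g) (pmap g') -> cancel (pmap g') (pmap g) ->
  tangent Y ->
  tangent (\row_i \sum_j msub g (g' i)^`M(j) * msub g (Y ord0 j)).
Proof.
move=> Gg gK g'K [P [Q [GP PQ QP P0 PY]]].
have Gg' := G_inv Gg gK g'K.
(* [lft] regards a polynomial in the space variables as one in time and space; [cj R] is the family
   [g' \o R_t \o g]. *)
pose lft := msub (fun i : 'I_n => 'X_(space i) : {mpoly K[1 + n]}).
pose inn (R : 'I_n -> {mpoly K[1 + n]}) j := msub (pt 'X_time (lft \o g)) (R j).
pose cj R i := msub (inn R) (g' i).
have flow_cj R t : flow (cj R) t =1 pmap g' \o (flow R t \o pmap g).
  move=> z; apply/rowP => i; rewrite !mxE meval_msub; apply: meval_eq => j.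
  rewrite !mxE meval_msub; apply: meval_eq.
  apply: pt_ind => [|k]; rewrite !ptE ?mevalXU ?ptE // mxE meval_msub.
  by apply: meval_eq => l; rewrite mevalXU ptE.
exists (cj P), (cj Q); split=> [t|t z|t z|z|i].
- by apply: G_ext (G_comp Gg' (G_comp (GP t) Gg)) => z; rewrite flow_cj.
- by rewrite !flow_cj /= g'K PQ gK.
- by rewrite !flow_cj /= g'K QP gK.
- by rewrite flow_cj /= P0 gK.
have dlft p : (lft p)^`M(time) = 0.
  by rewrite mderiv_msub big1 // => j _; rewrite mderiv_space_time mulr0.
have flft p : freeze 0 (lft p) = p.
  rewrite /freeze msub_msub -[RHS]msub_id; apply: eq_msub => j.
  by rewrite msubX ptE.
have fE p : freeze 0 (msub (pt 'X_time (lft \o g)) p) = msub g (freeze 0 p).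
  rewrite msub_freeze [LHS]msub_msub; apply: eq_msub.
  by apply: pt_ind => [|j]; rewrite !ptE ?msubX ?ptE //= -[LHS]/(freeze 0 _) flft.
rewrite mderiv_msub freeze_sum mxE; apply: eq_bigr => j _.
rewrite freezeM; congr (_ * _).
  rewrite /freeze msub_msub; apply: eq_msub => k; rewrite -/(freeze 0 _) fE.
  by rewrite flow0_freeze // msubX.
rewrite /inn mderiv_msub sum_pt freezeD freeze_sum big1 => [|k _].
  by rewrite addr0 freezeM fE PY ptE mderivXU eqxx freezeC mulr1.
by rewrite ptE /= dlft freezeM -mpolyC0 freezeC mpolyC0 mulr0.
Qed.

(* Replacing [q(t)] by [q(2 t) - 2 ^ d q(t)] kills the coefficient of degree
   [d] and multiplies the linear one by a nonzero constant. *)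
Lemma tangent_coef1 d (q : 'I_n -> {poly {mpoly K[n]}}) :
  (forall i, (size (q i) <= d)%N) ->
  (forall t, tangent (\row_i (q i).[t%:MP])) -> tangent (\row_i (q i)`_1).
Proof.
have base (q' : 'I_n -> {poly {mpoly K[n]}}) : (forall i, (size (q' i) <= 2)%N) ->
    (forall t, tangent (\row_i (q' i).[t%:MP])) -> tangent (\row_i (q' i)`_1).
  move=> q2 tq; suff -> : \row_i (q' i)`_1 =
      \row_i (q' i).[1%:MP] + (-1)%:MP *: \row_i (q' i).[0%:MP].
    by apply: tangentD => //; apply: tangentZ.
  apply/rowP => i; rewrite !mxE coef1_size2 //.
  by rewrite mpolyCN mpolyC1 mpolyC0 mulN1r.
elim: d q => [|[|[|d]] IH] q qd tq; try by apply: base => // i; apply: leq_trans (qd i) _.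
(* [D] bounds the degrees of the [q i], and [D >= 2] makes [2 - 2 ^+ D], the factor of the linear
   coefficient, nonzero. *)
pose D := d.+2.
pose q' i := \poly_(r < D) ((2 ^+ r - 2 ^+ D) * (q i)`_r).
have nz2 : (2 - 2 ^+ D : K) != 0.
  by rewrite subr_eq0 -natrX (eqr_nat K 2) -[X in X == _]expn1 eqn_exp2l.
have E2 : (2 - 2 ^+ D : K)%:MP = 2 - 2 ^+ D :> {mpoly K[n]}.
  by rewrite mpolyCB rmorphXn /= mpolyC_nat.
have -> : \row_i (q i)`_1 = ((2 - 2 ^+ D)^-1)%:MP *: \row_i (q' i)`_1.
  apply/rowP => i; rewrite !mxE coef_poly expr1 -E2 mulrA -mpolyCM.
  by rewrite mulVf // mpolyC1 mul1r.
apply: tangentZ; apply: IH => [i|t]; first exact: size_poly.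
suff -> : \row_i (q' i).[t%:MP] = \row_i (q i).[(2 * t)%:MP] +
    (- 2 ^+ D)%:MP *: \row_i (q i).[t%:MP].
  by apply: tangentD => //; apply: tangentZ.
apply/rowP => i; rewrite !mxE horner_dilate //.
by rewrite mpolyCM mpolyCN rmorphXn /= mpolyC_nat mulNr.
Qed.

(** Expanded in powers of time by [tops], the family has this derivative as its linear coefficient,
    which [tangent_coef1] obtains from finitely many times. No limit of difference quotients is
    taken. *)
Lemma tangent_dtime (Phi : 'I_n -> {mpoly K[1 + n]}) :
  (forall t, tangent (\row_i freeze t (Phi i))) ->
  tangent (\row_i freeze 0 (Phi i)^`M(time)).
Proof.
move=> tP.
have [tops [topsD topsM topsC topsX]] :
    exists tops : {mpoly K[1 + n]} -> {poly {mpoly K[n]}},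
    [/\ {morph tops : p q / p + q}, {morph tops : p q / p * q},
        forall a, tops a%:MP = a%:MP%:P
      & forall j, tops 'X_j = pt 'X (fun i : 'I_n => ('X_i)%:P) j].
  exists (mmap (polyC \o @mpolyC n K) (pt 'X (polyC \o vars))).
  split=> [p q|p q|a|j]; [exact: mmapD|by rewrite rmorphM|exact: mmapC|].
  by rewrite mmapX mmap1U.
have topsE t p : (tops p).[t%:MP] = freeze t p.
  elim/mpoly_ring_ind: p => [a|j|p q IHp IHq|p q IHp IHq].
  - by rewrite topsC hornerC freezeC.
  - rewrite topsX /freeze msubX; move: j; apply: pt_ind => [|j].
      by rewrite !ptE hornerX.
    by rewrite !ptE hornerC.
  - by rewrite topsD hornerD freezeD IHp IHq.
  - by rewrite topsM hornerM freezeM IHp IHq.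
have tops1 p : (tops p)`_1 = freeze 0 p^`M(time).
  elim/mpoly_ring_ind: p => [a|j|p q IHp IHq|p q IHp IHq].
  - by rewrite topsC coefC mderivC -mpolyC0 freezeC mpolyC0.
  - rewrite topsX; move: j; apply: pt_ind => [|j].
      by rewrite ptE coefX mderivXU eqxx freezeC mpolyC1.
    by rewrite ptE coefC mderiv_space_time -mpolyC0 freezeC mpolyC0.
  - by rewrite topsD coefD IHp IHq mderivD freezeD.
  - rewrite topsM coefM !big_ord_recl big_ord0 /= IHp IHq mderivM freezeD !freezeM.
    by rewrite -!topsE mpolyC0 !horner_coef0 addr0 addrC subnn.
have -> : \row_i freeze 0 (Phi i)^`M(time) = \row_i (tops (Phi i))`_1.
  by apply/rowP => i; rewrite !mxE tops1.
apply: (@tangent_coef1 (\max_i size (tops (Phi i)))) => [i|t].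
  exact: leq_bigmax.
suff -> : \row_i (tops (Phi i)).[t%:MP] = \row_i freeze t (Phi i) by [].
by apply/rowP => i; rewrite !mxE topsE.
Qed.

(* Pulling back [Y] by a family with velocity [Z] yields tangent fields that
   depend polynomially on the time; the linear coefficient is [Z, Y]. *)
Lemma tangent_bracket Z Y : tangent Z -> tangent Y -> tangent (bracket Z Y).
Proof.
move=> [P [Q [GP PQ QP P0 PZ]]] tY.
have Q0 z : flow Q 0 z = z by rewrite -{1}[z]P0 PQ.
(* The components of the conjugate field [DQ_t(P_t z) Y(P_t z)], with time as a variable. *)
pose Phi i : {mpoly K[1 + n]} := \sum_j msub (pt 'X_time P) (Q i)^`M(space j)
  * msub P (Y ord0 j).
have fP p : freeze 0 (msub (pt 'X_time P) p) = freeze 0 p.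
  rewrite /freeze msub_msub; apply: eq_msub.
  apply: pt_ind => [|j]; rewrite !ptE ?msubX ?ptE // -[LHS]/(freeze 0 _).
  exact: flow0_freeze.
have fP' p : freeze 0 (msub P p) = p.
  rewrite /freeze msub_msub -[RHS]msub_id; apply: eq_msub => j.
  exact: flow0_freeze.
have dP p : freeze 0 (msub (pt 'X_time P) p)^`M(time) = freeze 0 p^`M(time)
    + \sum_l freeze 0 p^`M(space l) * Z ord0 l.
  rewrite mderiv_msub sum_pt freezeD freeze_sum; congr (_ + _).
    by rewrite freezeM fP ptE mderivXU eqxx freezeC mulr1.
  by apply: eq_bigr => l _; rewrite freezeM fP ptE PZ.
(* Differentiating [Q_t(P_t z) = z] at time 0 shows that the inverse family has the opposite
   velocity. *)
have QZ i : freeze 0 (Q i)^`M(time) = - Z ord0 i.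
  have E : msub (pt 'X_time P) (Q i) = 'X_(space i).
    apply: mpoly_fun_inj => v; rewrite mevalXU.
    have := flow_comp Q P (v time) (\row_j v (space j)).
    rewrite /= PQ => /rowP/(_ i); rewrite !mxE => <-.
    apply: meval_eq; apply: pt_ind => [|j]; by rewrite !ptE ?mxE.
  have := dP (Q i); rewrite E mderiv_space_time -mpolyC0 freezeC mpolyC0.
  rewrite (bigD1 i) //= big1 => [|j ne]; rewrite (mderiv_freeze0 _ (flow0_freeze Q0 i)).
    by rewrite eqxx mul1r addr0 => /esym/eqP; rewrite addr_eq0 => /eqP.
  by rewrite (negbTE ne) mul0r.
have -> : bracket Z Y = \row_i freeze 0 (Phi i)^`M(time).
  apply/rowP => i; rewrite !mxE /Phi raddf_sum freeze_sum /=.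
  have dY y : freeze 0 (msub P y)^`M(time) = \sum_l y^`M(l) * Z ord0 l.
    by rewrite mderiv_msub freeze_sum; apply: eq_bigr => l _; rewrite freezeM fP' PZ.
  have dQ j : freeze 0 (Q i)^`M(space j)^`M(time) = - (Z ord0 i)^`M(j).
    by rewrite mderiv_comm -mderiv_freeze QZ mderivN.
  have ddQ j l : freeze 0 (Q i)^`M(space j)^`M(space l) = 0.
    by rewrite -!mderiv_freeze flow0_freeze // mderivXU mderivC.
  have termE j : freeze 0 (msub (pt 'X_time P) (Q i)^`M(space j) *
      msub P (Y ord0 j))^`M(time) = (j == i)%:R%:MP * (\sum_l (Y ord0 j)^`M(l) * Z ord0 l)
        - Y ord0 j * (Z ord0 i)^`M(j).
    rewrite mderivM freezeD !freezeM fP fP' dP dY dQ.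
    rewrite (mderiv_freeze0 _ (flow0_freeze Q0 i)) big1 => [|l _].
      by rewrite addr0 addrC mulNr [_ * Y _ _]mulrC.
    by rewrite ddQ mul0r.
  under [RHS]eq_bigr => j _ do rewrite termE.
  rewrite !sumrB; congr (_ - _).
  rewrite [RHS](bigD1 i) //= [X in _ = _ + X]big1 => [|j ne]; last first.
    by rewrite (negbTE ne) mpolyC0 mul0r.
  rewrite eqxx mpolyC1 mul1r addr0.
  by apply: eq_bigr => l _; rewrite mulrC.
apply: tangent_dtime => t.
suff -> : \row_i freeze t (Phi i) = \row_i \sum_j
    msub (freeze t \o P) (freeze t (Q i))^`M(j) * msub (freeze t \o P) (Y ord0 j).
  apply: tangent_conj => //.
  - by apply: G_ext (GP t) => z; rewrite [RHS]pmap_freeze.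
  - by move=> z; rewrite [pmap _ z]pmap_freeze [LHS]pmap_freeze PQ.
  - by move=> z; rewrite [pmap _ z]pmap_freeze [LHS]pmap_freeze QP.
apply/rowP => i; rewrite !mxE freeze_sum; apply: eq_bigr => j _.
rewrite freezeM mderiv_freeze; congr (_ * _); last by rewrite [LHS]msub_msub.
rewrite [RHS]msub_freeze [LHS]msub_msub; apply: eq_msub.
by apply: pt_ind => [|k]; rewrite !ptE ?msubX ?ptE.
Qed.

End Tangent.

(** * Hamiltonian fields *)

Notation "''e_' k" := (delta_mx ord0 k) (at level 8, k at level 2, format "''e_' k").

Section Brackets.
Variables (K : numFieldType) (n : nat).
Local Notation field := ('rV[{mpoly K[n]}]_n).
Implicit Types (Y Z : field) (f g h : {mpoly K[n]}).

Lemma bracketDl Z Z' Y : bracket (Z + Z') Y = bracket Z Y + bracket Z' Y.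
Proof.
apply/rowP => i; rewrite !mxE -big_split; apply: eq_bigr => l _ /=.
by rewrite !mxE mderivD mulrDl mulrDr opprD addrACA.
Qed.

Lemma bracketDr Z Y Y' : bracket Z (Y + Y') = bracket Z Y + bracket Z Y'.
Proof.
apply/rowP => i; rewrite !mxE -big_split; apply: eq_bigr => l _ /=.
by rewrite !mxE mderivD mulrDl mulrDr opprD addrACA.
Qed.

Lemma bracketNl Z Y : bracket (- Z) Y = - bracket Z Y.
Proof.
apply/rowP => i; rewrite !mxE -sumrN; apply: eq_bigr => l _ /=.
by rewrite !mxE mderivN mulNr mulrN opprD.
Qed.

Lemma bracketNr Z Y : bracket Z (- Y) = - bracket Z Y.
Proof.
apply/rowP => i; rewrite !mxE -sumrN; apply: eq_bigr => l _ /=.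
by rewrite !mxE mderivN mulNr mulrN opprD.
Qed.

Lemma scale_deltaE f (k i : 'I_n) : (f *: 'e_k : field) ord0 i = f *+ (i == k).
Proof. by rewrite !mxE eqxx mulr_natr. Qed.

Lemma bracket_delta f g j k : bracket (f *: 'e_j) (g *: 'e_k) =
  (f * g^`M(j)) *: 'e_k - (g * f^`M(k)) *: 'e_j.
Proof.
apply/rowP => i; rewrite mxE [RHS]mxE [X in _ = _ + X]mxE !scale_deltaE sumrB.
by congr (_ - _); [rewrite (bigD1 j)|rewrite (bigD1 k)] => //=;
  rewrite scale_deltaE eqxx big1 ?addr0 => [|l ne];
  rewrite ?scale_deltaE ?(negbTE ne) ?mul0r // linearMn mulrnAr.
Qed.

Lemma mderivXn i p k : (p ^+ k)^`M(i) = (p ^+ k.-1 * p^`M(i)) *+ k :> {mpoly K[n]}.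
Proof.
elim: k => [|k IH]; first by rewrite expr0 -mpolyC1 mderivC mulr0n.
rewrite exprS mderivM IH mulrnAr mulrA /= mulrS [p^`M(i) * _]mulrC; congr (_ + _).
by case: k {IH} => [|k]; rewrite ?mulr0n // exprS.
Qed.

(* The field of the Hamiltonian [h] for the bivector [d/dz_a /\ d/dz_b], the
   remaining coordinates being parameters. *)
Definition ham (a b : 'I_n) h : field := h^`M(b) *: 'e_a - h^`M(a) *: 'e_b.

(** The derivative of [h] along [ham a b g]; this sign makes [ham a b] compatible with the
    brackets. *)
Definition poisson (a b : 'I_n) g h := g^`M(b) * h^`M(a) - g^`M(a) * h^`M(b).

Lemma hamD a b g h : ham a b (g + h) = ham a b g + ham a b h.
Proof. by rewrite /ham !mderivD !scalerDl opprD addrACA. Qed.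

Lemma hamZ a b c h : ham a b (c%:MP * h) = c%:MP *: ham a b h.
Proof. by rewrite /ham !mderiv_mulC scalerBr !scalerA. Qed.

(** The identity behind [bracket_ham], with the derivatives of [g] and [h] as independent letters so
    that [ring] decides it. *)
Lemma ham_bracket_row (A : comNzRingType) (u v : 'rV[A]_n)
    (ga gb ha hb gaa gab gbb haa hab hbb : A) :
  (gb * hab) *: u - (hb * gab) *: u - ((gb * haa) *: v - (ha * gbb) *: u)
   - ((ga * hbb) *: u - (hb * gaa) *: v - ((ga * hab) *: v - (ha * gab) *: v))
  = (gbb * ha + gb * hab - (gab * hb + ga * hbb)) *: u
    - (gab * ha + gb * haa - (gaa * hb + ga * hab)) *: v.
Proof. by apply/rowP => i; rewrite !mxE; ring. Qed.

Lemma bracketBl Z Z' Y : bracket (Z - Z') Y = bracket Z Y - bracket Z' Y.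
Proof. by rewrite bracketDl bracketNl. Qed.

Lemma bracketBr Z Y Y' : bracket Z (Y - Y') = bracket Z Y - bracket Z Y'.
Proof. by rewrite bracketDr bracketNr. Qed.

Lemma bracket_ham a b g h : bracket (ham a b g) (ham a b h) = ham a b (poisson a b g h).
Proof.
rewrite /ham bracketBl 2!bracketBr 4!bracket_delta /poisson.
rewrite 2!mderivB 4!mderivM (mderiv_comm b a g) (mderiv_comm b a h).
exact: ham_bracket_row.
Qed.

End Brackets.

(** * All Hamiltonian fields in two variables from a few generators *)

Section HamiltonianFields.
Variables (K : numFieldType) (n : nat).
Local Notation field := ('rV[{mpoly K[n]}]_n).
Variable S : field -> Prop.
Hypothesis SD : forall Y Z, S Y -> S Z -> S (Y + Z).
Hypothesis SZ : forall c Y, S Y -> S (c%:MP *: Y).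
Hypothesis Sbr : forall Z Y, S Z -> S Y -> S (bracket Z Y).
Variables a b : 'I_n.
Hypothesis ab : a != b.
Hypothesis Sb0 : S 'e_a.
Hypothesis Sb2 : S ('X_b ^+ 2 *: 'e_a).
Hypothesis Sc : forall c, c != b -> S ('X_c *: 'e_b).
Local Notation T h := (S (ham a b h)).

Lemma scale_cancel (c : K) Y : c != 0 -> S (c%:MP *: Y) -> S Y.
Proof.
move=> c0 /(SZ c^-1); rewrite scalerA -mpolyCM mulVf // mpolyC1.
by rewrite scale1r.
Qed.

Lemma lie_poisson g h : T g -> T h -> T (poisson a b g h).
Proof. by move=> Tg Th; rewrite -bracket_ham; apply: Sbr. Qed.

Lemma lie_ham_cancel (c : K) h : c != 0 -> T (c%:MP * h) -> T h.
Proof. by rewrite hamZ => c0; apply: scale_cancel. Qed.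

Lemma lie_hamD g h : T g -> T h -> T (g + h).
Proof. by move=> Tg Th; rewrite hamD; exact: SD. Qed.

Lemma lie_hamZ c h : T h -> T (c%:MP * h).
Proof. by move=> Th; rewrite hamZ; exact: SZ. Qed.

Lemma lie_ham0 : T 0.
Proof.
have -> : ham a b (0 : {mpoly K[n]}) = (0 : K)%:MP *: 'e_a.
  by rewrite /ham !mderiv0 mpolyC0 !scale0r subr0.
exact: SZ.
Qed.

Lemma mderivXU_eq i : ('X_i : {mpoly K[n]})^`M(i) = 1.
Proof. by rewrite mderivXU eqxx mpolyC1. Qed.

Lemma mderivXU_ne i j : i != j -> ('X_j : {mpoly K[n]})^`M(i) = 0.
Proof. by move=> ij; rewrite mderivXU (negbTE ij) mpolyC0. Qed.

Let ba : b != a. Proof. by rewrite eq_sym. Qed.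

Let dbXb l : ('X_b ^+ l.+1 : {mpoly K[n]})^`M(b) = l.+1%:R%:MP * 'X_b ^+ l.
Proof. by rewrite mderivXn mderivXU_eq mulr1 mpolyC_nat mulr_natl. Qed.

Let daXb l : ('X_b ^+ l : {mpoly K[n]})^`M(a) = 0.
Proof. by rewrite mderivXn (mderivXU_ne ab) mulr0 mul0rn. Qed.

(** This Hamiltonian field is [- 'X_c *: 'e_b], doubled when [c = a]. *)
Lemma lie_ham_XaXc c : c != b -> T ('X_a * 'X_c).
Proof.
move=> cb; rewrite /ham !mderivM (mderivXU_ne ba) mul0r add0r.
rewrite mderivXU_eq mul1r (@mderivXU_ne b c) 1?eq_sym // mulr0 scale0r add0r.
have [->|ca] := eqVneq c a.
  rewrite mderivXU_eq mulr1 -mulr2n -mulr_natl -mpolyC_nat -scaleNr -mulNr -mpolyCN.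
  by rewrite -scalerA; apply: SZ; apply: Sc.
rewrite mderivXU_ne 1?eq_sym // mulr0 addr0 -scaleN1r -mpolyC1 -mpolyCN.
exact/SZ/Sc.
Qed.

(** Up to nonzero constants, the Poisson bracket with ['X_a ^+ 2] turns ['X_b ^+ l.+1] into
    ['X_a * 'X_b ^+ l], and the bracket with ['X_b ^+ 3] turns the latter into ['X_b ^+ l.+2]. *)
Lemma lie_ham_Xb l : T ('X_b ^+ l).
Proof.
have Tsmall k : S ('X_b ^+ k *: 'e_a) -> T ('X_b ^+ k.+1).
  by move=> Sk; rewrite /ham dbXb daXb scale0r subr0 -scalerA; apply: SZ.
case: l => [|l].
  have -> : ham a b ('X_b ^+ 0 : {mpoly K[n]}) = ham a b (0 : {mpoly K[n]}).
    by rewrite expr0 -mpolyC1 -mpolyC0 /ham !mderivC.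
  exact: lie_ham0.
elim: l => [|l IH]; first by apply: Tsmall; rewrite expr0 scale1r.
have T2 : T ('X_a * 'X_b ^+ l).
  apply: (@lie_ham_cancel (- (2 * l.+1%:R))).
    by rewrite oppr_eq0 mulf_neq0 // pnatr_eq0.
  have := lie_poisson (lie_ham_XaXc ab) IH.
  rewrite /poisson daXb dbXb mulr0 sub0r mderivM mderivXU_eq mulr1 mul1r.
  have -> : 'X_a + 'X_a = 2%:MP * 'X_a :> {mpoly K[n]}.
    by rewrite mpolyC_nat mulr_natl mulr2n.
  by rewrite mulrACA -mpolyCM mpolyCN mulNr.
apply: (@lie_ham_cancel 3); first by rewrite pnatr_eq0.
have := lie_poisson (Tsmall 2%N Sb2) T2.
rewrite /poisson daXb mul0r subr0 dbXb mderivM mderivXU_eq mul1r daXb mulr0 addr0.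
by rewrite -mulrA -exprD.
Qed.

Lemma prod_ind (good : {mpoly K[n]} -> Prop) (m : 'I_n -> nat) :
  good 1 -> (forall c p, c != b -> good p -> good ('X_c * p)) ->
  good (\prod_(i < n | i != b) 'X_i ^+ m i).
Proof.
move=> good1 goodX; apply: (big_rec good) => // i p ib gp.
elim: (m i) => [|k IH]; first by rewrite expr0 mul1r.
by rewrite exprS -mulrA; exact: goodX.
Qed.

(** Monomials are built one variable at a time: up to a nonzero constant, the Poisson bracket of
    ['X_a * 'X_c] and ['X_b ^+ l.+1 * m] is ['X_b ^+ l * ('X_c * m)] when [m] is free of ['X_b].
    Each step costs one power of ['X_b], so [good] treats all powers at once. *)
Lemma lie_ham h : T h.
Proof.
pose good m := m^`M(b) = 0 /\ forall l, T ('X_b ^+ l * m).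
have goodX c m : c != b -> good m -> good ('X_c * m).
  move=> cb [dm Tm]; split=> [|l].
    by rewrite mderivM dm mulr0 addr0 mderivXU_ne ?mul0r // eq_sym.
  have [k k0 kE] : exists2 k : K, k != 0 & ('X_a * 'X_c)^`M(a) = k%:MP * 'X_c.
    rewrite mderivM mderivXU_eq mul1r; have [->|ca] := eqVneq c a.
      exists 2; first by rewrite pnatr_eq0.
      by rewrite mderivXU_eq mulr1 mpolyC_nat mulr_natl mulr2n.
    exists 1; first by rewrite oner_eq0.
    by rewrite mderivXU_ne 1?eq_sym // mulr0 addr0 mpolyC1 mul1r.
  apply: (@lie_ham_cancel (- (k * l.+1%:R))).
    by rewrite oppr_eq0 mulf_neq0 // pnatr_eq0.
  have ub : ('X_a * 'X_c : {mpoly K[n]})^`M(b) = 0.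
    rewrite mderivM (mderivXU_ne ba) mul0r add0r mderivXU_ne ?mulr0 //.
    by rewrite eq_sym.
  have vb : ('X_b ^+ l.+1 * m)^`M(b) = l.+1%:R%:MP * ('X_b ^+ l * m).
    by rewrite mderivM dm mulr0 addr0 dbXb mulrA.
  have := lie_poisson (lie_ham_XaXc cb) (Tm l.+1).
  rewrite /poisson ub mul0r sub0r kE vb mulrACA -mpolyCM (mulrCA 'X_c ('X_b ^+ l) m).
  by rewrite mpolyCN mulNr.
have good1 : good 1.
  split=> [|l]; first by rewrite -mpolyC1 mderivC.
  by rewrite mulr1; apply: lie_ham_Xb.
elim/mpolyind: h => [|c m p _ _ Tp]; first exact: lie_ham0.
apply: lie_hamD Tp; rewrite -mul_mpolyC; apply: lie_hamZ.
rewrite mpolyXE_id (bigD1 b) //=.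
suff [_ H] : good (\prod_(i < n | i != b) 'X_i ^+ m i) by apply: H.
exact: prod_ind.
Qed.

Hypothesis Sk : forall k, k != a -> k != b -> S ('X_a *: 'e_k).

Definition evf (Y : field) (z : 'rV[K]_n) : 'rV[K]_n := pmap (fun i => Y ord0 i) z.

Lemma evfD Y Z z : evf (Y + Z) z = evf Y z + evf Z z.
Proof. by apply/rowP => i; rewrite !mxE mevalD. Qed.

Lemma evfZ f Y z : evf (f *: Y) z = f.@[z ord0] *: evf Y z.
Proof. by apply/rowP => i; rewrite !mxE mevalM. Qed.

Lemma evf_delta k z : evf 'e_k z = 'e_k.
Proof. by apply/rowP => i; rewrite !mxE eqxx /= rmorph_nat. Qed.

Lemma evf_ham h z : evf (ham a b h) z =
  h^`M(b).@[z ord0] *: 'e_a - h^`M(a).@[z ord0] *: 'e_b.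
Proof. by rewrite /ham -scaleNr evfD !evfZ !evf_delta mevalN scaleNr. Qed.

(** For each [j != i0] take an affine function of a coordinate distinguishing [x j] from [x i0],
    equal to 0 at [x j] and 1 at [x i0]; multiply these. *)
Lemma separate m (x : 'I_m -> 'rV[K]_n) i0 : injective x ->
  exists q : {mpoly K[n]}, forall j, q.@[x j ord0] = (j == i0)%:R.
Proof.
move=> xI.
have /fin_all_exists[l lE] j : exists l : {mpoly K[n]},
    l.@[x i0 ord0] = 1 /\ (j != i0 -> l.@[x j ord0] = 0).
  have [->|ne] := eqVneq j i0; first by exists 1; rewrite meval1.
  have [k xk] : exists k, x i0 ord0 k != x j ord0 k.
    apply/existsP; apply: contraNT ne; rewrite negb_exists => /forallP xE.
    by apply/eqP/xI/rowP => k; apply/esym/eqP; move: (xE k); rewrite negbK.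
  exists ((x i0 ord0 k - x j ord0 k)^-1%:MP * ('X_k - (x j ord0 k)%:MP)).
  rewrite !mevalM !mevalB !mevalXU !mevalC subrr mulr0; split=> //.
  by rewrite mulVf // subr_eq0.
exists (\prod_j l j) => j; rewrite rmorph_prod /=; have [->|ne] := eqVneq j i0.
  by rewrite big1 // => r _; case: (lE r).
by rewrite (bigD1 j) //=; have [_ ->] := lE j; rewrite ?mul0r.
Qed.

(** Hamiltonians that are linear to first order at [x i0] and flat at the other points give the
    directions [a] and [b]. Another direction [k] comes from the bracket of ['X_a *: 'e_k] with such
    a field, after a correction along [a] and [b]. *)
Lemma span_points m (x : 'I_m -> 'rV[K]_n) : injective x ->
  forall i0 k, exists2 Y, S Y & forall j, evf Y (x j) = (j == i0)%:R *: 'e_k.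
Proof.
move=> xI i0 k; have [q qE] := separate i0 xI.
(* The cube makes the first and second derivatives vanish at the other points; at [x i0], where [q]
   is 1, the gradient is the [c]-th basis vector. Second derivatives occur in [W] below. *)
pose h c := q ^+ 3 * ('X_c - (x i0 ord0 c)%:MP).
have dh c i : (h c)^`M(i) =
    q ^+ 2 * (3%:R * q^`M(i) * ('X_c - (x i0 ord0 c)%:MP) + q * (i == c)%:R%:MP).
  rewrite /h mderivM mderivXn mderivB mderivC subr0 mderivXU /=.
  rewrite [RHS]mulrDr; congr (_ + _).
    by rewrite -[(_ * _) *+ _]mulr_natl mulrCA -!mulrA.
  by rewrite exprSr -mulrA.
have dhE c i j : (h c)^`M(i).@[x j ord0] = ((j == i0) && (i == c))%:R.
  rewrite dh mevalM rmorphXn /= mevalD !mevalM mevalB mevalXU !mevalC qE.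
  have [->|_] := eqVneq j i0; last by rewrite expr0n mul0r.
  by rewrite subrr mulr0 add0r expr1n !mul1r.
have ddhE c i l j : j != i0 -> (h c)^`M(i)^`M(l).@[x j ord0] = 0.
  move=> ji; rewrite dh mderivM mevalD !mevalM mderivXn rmorphMn /= mevalM !rmorphXn /=.
  by rewrite qE (negbTE ji) expr0n !mul0r mul0rn mul0r addr0.
have Ya : exists2 Y, S Y & forall j, evf Y (x j) = (j == i0)%:R *: 'e_a.
  exists (ham a b (h b)); first exact: lie_ham.
  move=> j; rewrite evf_ham !dhE eqxx andbT (negbTE ab) andbF.
  by rewrite scale0r subr0.
have Yb : exists2 Y, S Y & forall j, evf Y (x j) = (j == i0)%:R *: 'e_b.
  exists ((-1)%:MP *: ham a b (h a)); first by apply/SZ/lie_ham.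
  move=> j; rewrite evfZ evf_ham !dhE eqxx andbT (negbTE ba) andbF mevalC.
  by rewrite scale0r sub0r scaleN1r opprK.
have [->//|ka] := eqVneq k a; have [->//|kb] := eqVneq k b.
have [Y1 SY1 Y1E] := Ya; have [Y2 SY2 Y2E] := Yb.
pose W := bracket ('X_a *: 'e_k) (ham a b (h b)).
have SW : S W by apply: Sbr; [exact: Sk | exact: lie_ham].
have WE : W = ('X_a * (h b)^`M(b)^`M(k)) *: 'e_a - (h b)^`M(b) *: 'e_k
              - ('X_a * (h b)^`M(a)^`M(k)) *: 'e_b.
  rewrite /W /ham bracketDr bracketNr !bracket_delta mderivXU_eq mulr1.
  by rewrite (mderivXU_ne ba) mulr0 scale0r subr0.
pose al := ('X_a * (h b)^`M(b)^`M(k)).@[x i0 ord0].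
pose be := ('X_a * (h b)^`M(a)^`M(k)).@[x i0 ord0].
(* At [x i0] the field [W] equals [al *: 'e_a - be *: 'e_b - 'e_k]. *)
exists (al%:MP *: Y1 + (- be)%:MP *: Y2 + (-1)%:MP *: W).
  by apply: SD; [apply: SD|]; apply: SZ.
move=> j; rewrite !evfD !evfZ Y1E Y2E !mevalC WE -!scaleNr !evfD !evfZ !evf_delta.
rewrite !mevalN dhE eqxx andbT.
have [->|ji] := eqVneq j i0.
  by rewrite -/al -/be; apply/rowP => r; rewrite !mxE /=; ring.
by rewrite !mevalM !ddhE // !mulr0 /= mulr0n oppr0 !scale0r !addr0 !scaler0 !addr0.
Qed.

End HamiltonianFields.

(** * Transitivity on tuples of points *)

Section Transitivity.
Variables (K : numClosedFieldType) (n : nat).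
Variable G : ('rV[K]_n -> 'rV[K]_n) -> Prop.
Hypothesis G_comp : forall g h, G g -> G h -> G (g \o h).
Hypothesis G_id : G id.

(** Compose the families listed in [s], each with its own time variable, and apply the result to
    [x]. Every family is the identity at time 0, so each partial derivative at the origin is the
    velocity at [x] of a single family; [uniq s] prevents a variable from being used twice. *)
Lemma word_map m (x : 'I_m -> 'rV[K]_n) N (P : 'I_N -> 'I_n -> {mpoly K[1 + n]})
    (s : seq 'I_N) :
  (forall r t, G (flow (P r) t)) -> (forall r z, flow (P r) 0 z = z) -> uniq s ->
  exists F : 'I_m -> 'I_n -> {mpoly K[N]},
  [/\ forall v, exists2 g, G g & forall j, g (x j) = \row_i (F j i).@[v],
      forall j i, (F j i).@[fun=> 0] = x j ord0 i
    & forall r j i, (F j i)^`M(r).@[fun=> 0] =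
        (r \in s)%:R * (freeze 0 (P r i)^`M(time)).@[x j ord0]].
Proof.
move=> GP P0; elim: s => [_|r0 s IH /= /andP[r0s us]].
  exists (fun j i => (x j ord0 i)%:MP); split=> [v|j i|r j i].
  - by exists id => // j; apply/rowP => i; rewrite mxE mevalC.
  - by rewrite mevalC.
  - by rewrite mderivC meval0 mul0r.
have [F [Fg F0 dF]] := IH us.
have F0E j p : (msub (pt 'X_r0 (F j)) p).@[fun=> 0] = (freeze 0 p).@[x j ord0].
  rewrite meval_freeze meval_msub; apply: meval_eq.
  by apply: pt_ind => [|i]; rewrite !ptE ?mevalXU ?F0.
exists (fun j i => msub (pt 'X_r0 (F j)) (P r0 i)); split=> [v|j i|r j i].
- have [g Gg gE] := Fg v; exists (flow (P r0) (v r0) \o g); first exact: G_comp.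
  move=> j; rewrite /= gE; apply/rowP => i; rewrite !mxE meval_msub.
  by apply: meval_eq; apply: pt_ind => [|l]; rewrite !ptE ?mevalXU ?mxE.
- by rewrite F0E flow0_freeze // mevalXU.
rewrite mderiv_msub sum_pt mevalD raddf_sum /= mevalM F0E (bigD1 i) //= big1.
  rewrite mevalM F0E (mderiv_freeze0 _ (flow0_freeze (P0 r0) i)) eqxx mevalC.
  rewrite mul1r addr0 !ptE dF mderivXU mevalC inE.
  have [->|ne] := eqVneq r r0; first by rewrite (negbTE r0s) mul0r addr0 mulr1 mul1r.
  by rewrite mulr0 add0r.
move=> l ne; rewrite mevalM F0E (mderiv_freeze0 _ (flow0_freeze (P0 r0) i)).
by rewrite (negbTE ne) mevalC mul0r.
Qed.

Hypothesis span : forall m (x : 'I_m -> 'rV[K]_n), injective x ->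
  forall i0 k, exists2 Y, tangent G Y & forall j, evf Y (x j) = (j == i0)%:R *: 'e_k.

(** Choose one family for each pair of a point and a coordinate, with velocity at [x] the
    corresponding basis vector of the space of [m]-tuples. The map of [word_map] then has the
    identity as Jacobian matrix at the origin, so it is dominant. *)
Lemma orbit_generic m (x : 'I_m -> 'rV[K]_n) : injective x ->
  exists2 h : {mpoly K[#|{: 'I_m * 'I_n}|]}, h != 0 &
    forall w, h.@[w] != 0 -> exists2 g, G g &
      forall j, g (x j) = \row_i w (enum_rank (j, i)).
Proof.
move=> xI; set N := #|_|.
have /fin_all_exists[P PE] (r : 'I_N) : exists P : 'I_n -> {mpoly K[1 + n]},
    [/\ forall t, G (flow P t), forall z, flow P 0 z = z & forall i j,
      (freeze 0 (P i)^`M(time)).@[x j ord0] =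
        ((j == (enum_val r).1) && (i == (enum_val r).2))%:R].
  have [Y [P [Q [GP _ _ P0 PY]]] YE] := span xI (enum_val r).1 (enum_val r).2.
  exists P; split=> // i j; rewrite PY; have /rowP/(_ i) := YE j.
  by rewrite !mxE => ->; rewrite eqxx /= -natrM mulnb.
have GP r t : G (flow (P r) t) by case: (PE r).
have P0 r z : flow (P r) 0 z = z by case: (PE r).
have [F [Fg F0 dF]] := word_map x GP P0 (enum_uniq 'I_N).
pose f (r : 'I_N) := F (enum_val r).1 (enum_val r).2.
have [|h h0 hE] := @dominant_image K N N f.
  apply: (@dominant_inj _ _ _ _ id); apply/eqP => /(congr1 (meval (fun=> 0))).
  rewrite meval0 -det_map_mx => /eqP; apply/negP.
  suff -> : map_mx (meval (fun=> 0)) (\matrix_(i, j < N) (f j)^`M(i)) = 1%:M.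
    by rewrite det1 oner_neq0.
  apply/matrixP => r r'; rewrite !mxE dF mem_enum mul1r.
  case: (PE r) => _ _ ->; rewrite -(inj_eq enum_val_inj) [enum_val r == _]eq_sym.
  by case: (enum_val r) (enum_val r') => [j i] [j' i']; rewrite xpair_eqE.
exists h => // w /hE[v vE]; have [g Gg gE] := Fg v; exists g => // j.
rewrite gE; apply/rowP => i; rewrite !mxE -vE /f enum_rankK //.
Qed.

Hypothesis G_inv : forall g, G g -> exists2 h, G h & cancel g h.

Lemma transitive_points m (x y : 'I_m -> 'rV[K]_n) : injective x -> injective y ->
  exists2 g, G g & forall j, g (x j) = y j.
Proof.
move=> /orbit_generic[h h0 hE] /orbit_generic[k k0 kE].
have [w hkw] : exists w, (h * k).@[w] != 0.
  apply: boolp.contrapT => H; have /eqP[] := mulf_neq0 h0 k0.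
  apply: mpoly_fun0 => w; apply/eqP/negPn/negP => hk; apply: H; by exists w.
move: hkw; rewrite mevalM mulf_eq0 negb_or => /andP[/hE[g1 G1 g1E] /kE[g2 G2 g2E]].
have [g2' G2' g2K] := G_inv G2.
by exists (g2' \o g1) => [|j]; [exact: G_comp | rewrite /= g1E -g2E g2K].
Qed.

End Transitivity.

(** * Constant and linear fields extracted from the three given fields *)

Section Generators.
Variables (K : numFieldType) (n : nat).
Local Notation field := ('rV[{mpoly K[n]}]_n).
Variable S : field -> Prop.
Hypothesis SZ : forall c Y, S Y -> S (c%:MP *: Y).
Hypothesis Sbr : forall Z Y, S Z -> S Y -> S (bracket Z Y).

Lemma bracket_pd k (Y : field) : bracket 'e_k Y = \row_i (Y ord0 i)^`M(k).
Proof.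
apply/rowP => i; rewrite !mxE (bigD1 k) //= big1 => [|l ne].
  by rewrite !mxE !eqxx mul1r -mpolyC_nat mderivC mulr0 subr0 addr0.
by rewrite !mxE (negbTE ne) andbF mul0r -mpolyC_nat mderivC mulr0 subr0.
Qed.

Lemma lie_mderivm (D : 'X_{1..n}) (Y : field) :
  (forall j, (0 < D j)%N -> S 'e_j) -> S Y -> S (\row_i (Y ord0 i)^`M[D]).
Proof.
move=> SD SY; rewrite /mderivm; elim: (enum _) => [|j s IH] /=.
  suff -> : \row_i Y ord0 i = Y by [].
  by apply/rowP => i; rewrite mxE.
have := SD j; elim: (D j) => //= d IHd Sj.
have {}IHd := IHd (fun _ => Sj isT).
have := Sbr (Sj isT) IHd; rewrite bracket_pd.
by under eq_mx => i k do rewrite mxE.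
Qed.

(* Differentiating the coefficients amounts to bracketing with constant fields;
   [D] is to annihilate all components but one. *)
Lemma lie_extract (M : 'I_n -> 'X_{1..n}) (D : 'X_{1..n}) i0 :
  S (\row_i 'X_[M i]) -> (forall j, (0 < D j)%N -> S 'e_j) ->
  (D <= M i0)%MM -> (forall i, i != i0 -> exists j, (M i j < D j)%N) ->
  S ('X_[M i0 - D] *: 'e_i0).
Proof.
(* [c] is the product of falling factorials that the derivation [D] produces on ['X_[M i0]]; it is
   nonzero since [D <= M i0]. *)
move=> SM SD DM kill; pose c := (\prod_j (M i0 j) ^_ (D j))%N.
have c0 : (c%:R : K) != 0.
  rewrite pnatr_eq0 -lt0n prodn_gt0 // => j; rewrite ffact_gt0.
  exact/mnm_lepP.
apply: (scale_cancel SZ c0).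
have := lie_mderivm SD SM; congr S; apply/rowP => i; rewrite !mxE eqxx /=.
rewrite mderivmX; have [->|ne] := eqVneq i i0.
  by rewrite mulr1 mul_mpolyC.
have [j Mj] := kill i ne.
rewrite mulr0 mulr0 (bigD1 j) //= ffact_small // mul0n scale0r //.
Qed.

(** Indices start at 0 here, so component [i] of V' is the term [k = i.+2] of its sum. For the last
    index all exponents are 0, which gives the constant component. *)
Definition expo' (i : 'I_n) : 'X_{1..n} :=
  [multinom (if j == i.+1 :> nat then 5 else if (i.+1 < j)%N then 2 else 0) | j < n].

(** Component [i] of V'' is the term [k = i.+1] of its sum; for [i = 0] all exponents are 0. *)
Definition expo'' (i : 'I_n) : 'X_{1..n} :=
  [multinom (if j.+1 == i then 5 else if (j.+1 < i)%N then 2 else 0) | j < n].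

Hypothesis lie_last : forall i : 'I_n, i.+1 = n -> S 'e_i.
Hypothesis S' : S (\row_i 'X_[expo' i]).
Hypothesis S'' : S (\row_i 'X_[expo'' i]).

Let mnmU d (k : 'I_n) (m : 'X_{1..n}) : (forall j, m j = ((j == k) * d)%N) ->
  'X_[m] = 'X_k ^+ d :> {mpoly K[n]}.
Proof.
move=> mE; rewrite mpolyXn; congr 'X_[_]; apply/mnmP => j.
by rewrite mE mulmnE mnm1E eq_sym.
Qed.

(** Differentiate V' [5 - d] times in ['X_k] and twice in each later variable. In the components
    other than [i] the exponent of ['X_k] is 2 or 0, less than [5 - d] because [d <= 2], so they
    disappear. Only constant fields of index above [i] are involved, which permits a descending
    induction. *)
Lemma lie_down_of (i k : 'I_n) d : (d <= 2)%N -> k = i.+1 :> nat ->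
  (forall j : 'I_n, (i < j)%N -> S 'e_j) -> S ('X_k ^+ d *: 'e_i).
Proof.
move=> d2 ki Sj.
pose D : 'X_{1..n} :=
  [multinom (if j == i.+1 :> nat then 5 - d else if (i.+1 < j)%N then 2 else 0) | j < n].
rewrite -(@mnmU d k (expo' i - D)); last first.
  move=> j; rewrite mnmBE !mnmE -val_eqE /= ki.
  case: eqP => _; first by rewrite mul1n subKn // (leq_trans d2).
  by rewrite mul0n; case: ifP; rewrite subnn.
apply: lie_extract => // [j||l li].
- rewrite mnmE; case: eqP => [jE _|_]; first by apply: Sj; rewrite jE.
  by case: ifP => // ij _; apply: Sj; apply: ltn_trans ij.
- by apply/mnm_lepP => j; rewrite !mnmE; case: eqP => // _; rewrite leq_subr.
- exists k; rewrite !mnmE ki eqxx; move: li; rewrite -val_eqE /= neq_ltn => /orP[li|il].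
    rewrite eqSS (gtn_eqF li) ltnS li.
    by case: d d2 {D} => [|[|[|]]].
  rewrite eqSS (ltn_eqF il) ltnS [(l < i)%N]ltnNge (ltnW il) /=.
  by case: d d2 {D} => [|[|[|]]].
Qed.

(** Descending induction from the last index, where the field is U, by [lie_down_of] with
    [d = 0]. *)
Lemma lie_delta (i : 'I_n) : S 'e_i.
Proof.
have [d] := ubnP (n - i)%N; elim: d i => // d IH i id.
have [ni|] := leqP n i.+1; first by apply: lie_last; apply/eqP; rewrite eqn_leq ni andbT.
move=> ni; rewrite -[X in S X]scale1r -(expr0 'X_(Ordinal ni)).
apply: lie_down_of => // j ij; apply: IH.
by rewrite -ltnS; apply: leq_trans id; rewrite ltnS ltn_sub2l.
Qed.

Lemma lie_down (i k : 'I_n) d : (d <= 2)%N -> k = i.+1 :> nat -> S ('X_k ^+ d *: 'e_i).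
Proof. by move=> d2 ki; apply: lie_down_of => // j _; exact: lie_delta. Qed.

Lemma lie_up (i k : 'I_n) : k.+1 = i :> nat -> S ('X_k *: 'e_i).
Proof.
move=> ki.
(* Four derivatives make the fifth power of ['X_k] linear and kill the other components, where its
   exponent is 2 or 0. *)
pose D : 'X_{1..n} :=
  [multinom (if j.+1 == i then 4 else if (j.+1 < i)%N then 2 else 0) | j < n].
rewrite -['X_k]expr1 -(@mnmU 1 k (expo'' i - D)); last first.
  move=> j; rewrite mnmBE !mnmE -val_eqE /= -ki eqSS.
  by case: eqP => _ //; case: ifP; rewrite subnn.
apply: lie_extract => // [j _||l li]; first exact: lie_delta.
- by apply/mnm_lepP => j; rewrite !mnmE; case: eqP.
- exists k; rewrite !mnmE ki eqxx; move: li; rewrite -val_eqE /= neq_ltn => /orP[li|il].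
    by rewrite (gtn_eqF li) [(i < l)%N]ltnNge (ltnW li).
  by rewrite (ltn_eqF il) il.
Qed.

(** The commutation relation of elementary matrices, for linear fields; it propagates the fields
    between neighbouring indices to all pairs. *)
Lemma lie_linear_trans (p q r : 'I_n) : p != r ->
  S ('X_p *: 'e_q) -> S ('X_q *: 'e_r) -> S ('X_p *: 'e_r).
Proof.
move=> pr /Sbr H /H; rewrite bracket_delta mderivXU_eq mulr1.
by rewrite mderivXU_ne 1?eq_sym // mulr0 scale0r subr0.
Qed.

Lemma lie_upper (c j : 'I_n) : (c < j)%N -> S ('X_c *: 'e_j).
Proof.
have [d] := ubnP (j - c)%N; elim: d j => // d IH j jd cj.
have [cj1|jc] := ltnP c.+1 j; last first.
  by apply: lie_up; apply/eqP; rewrite eqn_leq cj jc.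
have j0 : (0 < j)%N by apply: leq_ltn_trans cj.
have jn : (j.-1 < n)%N by rewrite prednK // ltnW.
apply: (@lie_linear_trans _ (Ordinal jn)); first by rewrite -val_eqE neq_ltn cj.
  apply: IH => /=; last by rewrite -ltnS prednK.
  by rewrite -ltnS; apply: leq_trans jd; rewrite ltnS ltn_sub2r ?prednK // -ltnS prednK.
by apply: lie_up; rewrite /= prednK.
Qed.

Lemma lie_lower (c j : 'I_n) : (j < c)%N -> S ('X_c *: 'e_j).
Proof.
have [d] := ubnP (c - j)%N; elim: d j => // d IH j jd jc.
have [jc1|cj] := ltnP j.+1 c; last first.
  by rewrite -['X_c]expr1; apply: lie_down => //; apply/eqP; rewrite eqn_leq cj jc.
have jn : (j.+1 < n)%N by apply: ltn_trans (ltn_ord c).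
apply: (@lie_linear_trans _ (Ordinal jn)); first by rewrite -val_eqE neq_ltn jc orbT.
  by apply: IH => //=; rewrite -ltnS; apply: leq_trans jd; rewrite ltnS ltn_sub2l.
by rewrite -['X_(Ordinal jn)]expr1; apply: lie_down.
Qed.

Hypothesis SD : forall Y Z, S Y -> S Z -> S (Y + Z).

Lemma generators_span m (x : 'I_m -> 'rV[K]_n) : (2 <= n)%N -> injective x ->
  forall i0 k, exists2 Y, S Y & forall j, evf Y (x j) = (j == i0)%:R *: 'e_k.
Proof.
move=> n2 xI.
have n0 : (0 < n)%N by apply: ltnW.
have bn : (n.-1 < n)%N by rewrite prednK.
have an : (n.-2 < n)%N by apply: leq_ltn_trans (leq_pred _) bn.
(* The last two indices: all [c != b] lie below [b] and all other [k] lie below [a], as [lie_upper]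
   and [lie_lower] require. *)
pose a := Ordinal an; pose b := Ordinal bn.
have ba : b = a.+1 :> nat by rewrite /= prednK // -ltnS prednK.
have ab : (a < b)%N by rewrite ba.
apply: (@span_points K n S SD SZ Sbr a b) => //.
- by rewrite -val_eqE neq_ltn ab.
- exact: lie_delta.
- by apply: lie_down.
- move=> c; rewrite -val_eqE neq_ltn => /orP[|bc]; first exact: lie_upper.
  have : (c <= n.-1)%N by rewrite -ltnS prednK.
  by rewrite leqNgt bc.
- move=> k ka kb; apply: lie_lower.
  have : (k <= n.-1)%N by rewrite -ltnS prednK.
  rewrite leq_eqVlt -[n.-1]/(val b) (inj_eq val_inj) (negbTE kb) [val b]ba ltnS leq_eqVlt.
  by rewrite (inj_eq val_inj) (negbTE ka).
Qed.

End Generators.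

(** * Flows of triangular fields *)

Lemma deriv_eq0 (K : numFieldType) (p : {poly K}) : p^`() = 0 -> p = (p.[0])%:P.
Proof.
move=> dp; apply/polyP => i; rewrite coefC horner_coef0; case: i => [//|i] /=.
have /(congr1 (coefp i)) := dp; rewrite /= coef_deriv coef0 => /eqP.
by rewrite mulrn_eq0 => /eqP.
Qed.

Section TriangularFlow.
Variables (K : numFieldType) (n : nat) (c : 'I_n -> K) (M : 'I_n -> 'X_{1..n}).
Variable rho : 'I_n -> nat.
Hypothesis triangular : forall i j, M i j != 0%N -> (rho j < rho i)%N.
Local Notation a i := (c i *: 'X_[M i] : {mpoly K[n]}).

Lemma mmap_triangular (S : comNzRingType) (f : {rmorphism K -> S}) (h h' : 'I_n -> S) i :
  (forall j, (rho j < rho i)%N -> h j = h' j) -> mmap f h (a i) = mmap f h' (a i).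
Proof.
move=> hh'; rewrite !mmapZ !mmapX; congr (_ * _); apply: eq_bigr => j _.
by have [->|/triangular/hh'->] := eqVneq (M i j) 0%N; rewrite ?expr0.
Qed.

Lemma antiderivative (p : {mpoly K[1 + n]}) :
  exists q, q^`M(time) = p /\ freeze 0 q = 0.
Proof.
elim/mpolyind: p => [|b m p _ _ [q [dq q0]]].
  by exists 0; split; [exact: mderiv0 | exact: mmap0].
exists ((b / (m time).+1%:R) *: 'X_[m + U_(time)] + q).
rewrite mderivD mderivZ mderivX mnmDE mnm1E eqxx addn1 scalerA divfK ?pnatr_eq0 //.
rewrite addmK dq; split=> //.
rewrite freezeD q0 addr0 -mul_mpolyC freezeM mpolyXD freezeM freeze_time.
by rewrite mpolyC0 !mulr0.
Qed.

(** Integrate the components by increasing rank: the right-hand side for [i] involves only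
    components already found, so it is polynomial in time and has a polynomial antiderivative. *)
Lemma flow_exists : exists P : 'I_n -> {mpoly K[1 + n]},
  forall i, (P i)^`M(time) = msub P (a i) /\ freeze 0 (P i) = 'X_i.
Proof.
suff H k : exists P : 'I_n -> {mpoly K[1 + n]}, forall i, (rho i < k)%N ->
    (P i)^`M(time) = msub P (a i) /\ freeze 0 (P i) = 'X_i.
  have [P PE] := H (\max_i rho i).+1; exists P => i; apply: PE.
  by rewrite ltnS leq_bigmax.
elim: k => [|k [P PE]]; first by exists (fun i => 'X_(space i)).
have /fin_all_exists[q qE] i := antiderivative (msub P (a i)).
pose P' i := if (rho i < k)%N then P i else 'X_(space i) + q i.
exists P' => i ik.
have -> : msub P' (a i) = msub P (a i).
  by apply: mmap_triangular => j ji; rewrite /P' (leq_trans ji).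
rewrite /P'; case: ifP => [/PE //|_]; have [dq q0] := qE i.
by rewrite mderivD dq mderiv_space_time add0r freezeD q0 freeze_space addr0.
Qed.

(** Induction on the rank: the right-hand sides for [i] agree, so [u i - v i] is a constant, which
    is 0 by the initial values. *)
Lemma ode_unique (u v : 'I_n -> {poly K}) :
  (forall i, (u i)^`() = psub u (a i)) -> (forall i, (v i)^`() = psub v (a i)) ->
  (forall i, (u i).[0] = (v i).[0]) -> forall i, u i = v i.
Proof.
move=> du dv uv0 i; have [k ik] := ubnP (rho i); elim: k i ik => // k IH i ik.
apply/eqP; rewrite -subr_eq0; apply/eqP.
rewrite (@deriv_eq0 _ (u i - v i)).
  by rewrite hornerD hornerN uv0 subrr.
rewrite derivB du dv; apply/eqP; rewrite subr_eq0; apply/eqP.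
apply: mmap_triangular => j ji; apply: IH; exact: leq_trans ji _.
Qed.

Lemma triangular_flow : exists P : 'I_n -> {mpoly K[1 + n]},
  [/\ forall z, flow P 0 z = z,
      forall s t z, flow P (s + t) z = flow P s (flow P t z),
      forall z, exists u : 'I_n -> {poly K}, forall t i,
        flow P t z ord0 i = (u i).[t] /\ (u i)^`().[t] = (a i).@[flow P t z ord0]
    & forall i, freeze 0 (P i)^`M(time) = a i].
Proof.
have [P PE] := flow_exists; exists P.
pose u (z : 'rV[K]_n) i := psub (pt 'X (fun l => (z ord0 l)%:P)) (P i).
have uE z t i : (u z i).[t] = flow P t z ord0 i.
  rewrite mxE horner_psub; apply: meval_eq.
  by apply: pt_ind => [|j]; rewrite !ptE ?hornerX ?hornerC.
have du z i : (u z i)^`() = psub (u z) (a i).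
  rewrite deriv_psub sum_pt !ptE derivX mulr1 big1 => [|l _].
    by rewrite addr0 (PE i).1 psub_msub.
  by rewrite ptE derivC mulr0.
have P0 z : flow P 0 z = z.
  apply/rowP => i; rewrite mxE -(mevalXU (z ord0)) -(PE i).2 meval_freeze.
  by [].
split=> // [s t z|z|i].
- apply/rowP => i; rewrite -!uE.
  (* Both sides solve the differential equation with initial value [flow P t z]; uniqueness gives
     the group law. *)
  suff -> : u (flow P t z) i = u z i \Po ('X + t%:P).
    by rewrite horner_comp hornerD hornerX hornerC.
  apply/esym/(@ode_unique (fun i => u z i \Po ('X + t%:P))) => // {}i.
    rewrite deriv_comp du derivD derivX derivC addr0 mulr1 /psub.
    rewrite (@rmorph_mmap _ _ _ _ (comp_poly ('X + t%:P)) _ polyC) // => b.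
    by rewrite /= comp_polyC.
  by rewrite horner_comp hornerD hornerX hornerC add0r !uE P0.
- exists (u z) => t i; rewrite uE; split=> //.
  rewrite du horner_psub; apply: meval_eq => j; exact: uE.
rewrite (PE i).1 /freeze msub_msub -[RHS]msub_id; apply: eq_msub => j.
exact: (PE j).2.
Qed.

End TriangularFlow.

(** * The fields of the theorem *)

Section FieldCoordinates.
Variables (K : numFieldType) (n : nat).
Implicit Types (z : 'rV[K]_n) (i : 'I_n).

Definition monomial_field (c : 'I_n -> K) (M : 'I_n -> 'X_{1..n}) :
  'rV[{mpoly K[n]}]_n := \row_i (c i *: 'X_[M i]).

Lemma zcoordE z i : zcoord z i.+1 = z ord0 i.
Proof. by rewrite /zcoord /= valK. Qed.

Lemma meval_monomial z (e : nat -> nat) (m : 'X_{1..n}) : (forall j, m j = e j) ->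
  ('X_[m] : {mpoly K[n]}).@[z ord0] = \prod_(0 <= j < n) zcoord z j.+1 ^+ e j.
Proof.
by move=> mE; rewrite mevalX big_mkord; apply: eq_bigr => j _; rewrite mE zcoordE.
Qed.

Lemma fieldU_coord z i :
  fieldU z ord0 i = ((i.+1 == n)%:R *: ('X_[0] : {mpoly K[n]})).@[z ord0].
Proof. by rewrite mevalZ mpolyX0 meval1 mulr1 !mxE. Qed.

Lemma fieldV'_coord z i : fieldV' z ord0 i = (1 *: 'X_[expo' i]).@[z ord0].
Proof.
rewrite scale1r (@meval_monomial z
  (fun j => if j == i.+1 then 5 else if (i.+1 < j)%N then 2 else 0)); last first.
  by move=> j; rewrite mnmE.
rewrite mxE summxE !mxE.
have [ni|in_] := leqP n i.+1.
  have -> : i.+1 = n by apply/eqP; rewrite eqn_leq ltn_ord ni.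
  rewrite eqxx [X in _ + X]big1_seq ?addr0 => [|k]; last first.
    rewrite mem_index_iota => /andP[_ /andP[k2 kn]].
    rewrite !mxE (_ : (_ == _) = false) ?mulr0 //.
    by rewrite gtn_eqF // -ltnS prednK ?(leq_trans kn) // ltnW.
  rewrite big1_seq // => j /andP[_]; rewrite mem_index_iota => /andP[_ jn].
  by rewrite (ltn_eqF jn) ltnNge (ltnW jn) expr0.
(* Only the summand [k = i.+2] points along the coordinate of index [i]. *)
rewrite (ltn_eqF in_) add0r (bigD1_seq i.+2) ?mem_index_iota ?iota_uniq //=.
rewrite !mxE eqxx mulr1 [X in _ + X]big1_seq ?addr0 => [|k]; last first.
  rewrite mem_index_iota => /andP[ki /andP[k2 kn]].
  rewrite !mxE (_ : (_ == _) = false) ?mulr0 //; apply: contraNF ki => /eqP ik.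
  by rewrite ik prednK // ltnW.
rewrite [RHS](@big_cat_nat _ _ _ i.+1) //= ?(ltnW in_) //.
rewrite [X in _ = X * _]big1_seq => [|j]; last first.
  rewrite mem_index_iota => /andP[_ /andP[_ ji]].
  by rewrite (ltn_eqF ji) ltnNge (ltnW ji) expr0.
rewrite mul1r [RHS]big_ltn // eqxx mulrC; congr (_ * _).
rewrite big_add1 /=; apply: eq_big_nat => j /andP[ij _].
by rewrite (gtn_eqF ij) ij.
Qed.

Lemma fieldV''_coord z i : fieldV'' z ord0 i = (1 *: 'X_[expo'' i]).@[z ord0].
Proof.
rewrite scale1r (@meval_monomial z
  (fun j => if j.+1 == i then 5 else if (j.+1 < i)%N then 2 else 0)); last first.
  by move=> j; rewrite mnmE.
rewrite mxE summxE !mxE eqSS.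
have [i0|i_gt0] := posnP i.
  rewrite i0 [X in _ + X]big1_seq ?addr0 => [|k]; last first.
    rewrite mem_index_iota => /andP[_ /andP[k2 _]].
    by rewrite !mxE i0 (ltn_eqF k2) mulr0.
  by rewrite big1 // => j _; rewrite ltn0 expr0.
rewrite mulr0n add0r.
have in1 : i.+1 \in index_iota 2 n.+1 by rewrite mem_index_iota !ltnS i_gt0 ltn_ord.
(* Here the only summand along this coordinate is [k = i.+1]. *)
rewrite (bigD1_seq i.+1) ?iota_uniq //=.
rewrite !mxE eqxx mulr1 [X in _ + X]big1 ?addr0 => [|k ki]; last first.
  by rewrite !mxE eq_sym (negbTE ki) mulr0.
rewrite [RHS](@big_cat_nat _ _ _ i) //= ?(ltnW (ltn_ord i)) //.
rewrite [X in _ = _ * X]big1_seq => [|j]; last first.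
  rewrite mem_index_iota => /andP[_ /andP[ij _]].
  by rewrite gtn_eqF ?ltnS // ltnNge (leq_trans ij) ?expr0.
rewrite mulr1 -(prednK i_gt0) [RHS]big_nat_recr //= eqxx; congr (_ * _).
rewrite big_add1 /=; apply: eq_big_nat => j /andP[_ ji].
by rewrite eqSS (ltn_eqF ji) ltnS ji.
Qed.

Lemma monomial_fieldU i : i.+1 = n ->
  monomial_field (fun j => (j.+1 == n)%:R) (fun=> 0%MM) = 'e_i.
Proof.
move=> ni; apply/rowP => j; rewrite !mxE eqxx /= mpolyX0.
have -> : (j.+1 == n) = (j == i).
  by apply/eqP/eqP => [jn|->//]; apply/val_inj/succn_inj; rewrite [LHS]jn [RHS]ni.
by case: eqP => _; rewrite ?scale1r ?scale0r.
Qed.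

Lemma monomial_field1 M : monomial_field (fun=> 1) M = \row_i 'X_[M i].
Proof. by apply/rowP => i; rewrite !mxE scale1r. Qed.

End FieldCoordinates.

(** * Polynomial one-parameter groups and their velocities *)

Section FlowGroups.
Variables (K : numFieldType) (n : nat) (P : 'I_n -> {mpoly K[1 + n]}).
Hypothesis flow0 : forall z, flow P 0 z = z.
Hypothesis flowD : forall s t z, flow P (s + t) z = flow P s (flow P t z).

Lemma flow_unipotent : unipotent_subgroup (flow P).
Proof.
split=> //; exists P => t z i; rewrite mxE; apply: meval_eq.
apply: pt_ind => [|j]; first by rewrite ptE row_mxEl mxE eqxx.
by rewrite ptE row_mxEr.
Qed.

(** By the group law the inverse family is the flow at time [- t], again polynomial. *)
Lemma flow_tangent (G : ('rV[K]_n -> 'rV[K]_n) -> Prop) :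
  (forall t, G (flow P t)) -> tangent G (\row_i freeze 0 (P i)^`M(time)).
Proof.
move=> GP.
pose Q i := msub (pt (- 'X_time) (fun j : 'I_n => 'X_(space j) : {mpoly K[1 + n]})) (P i).
have flowQ t z : flow Q t z = flow P (- t) z.
  apply/rowP => i; rewrite !mxE meval_msub; apply: meval_eq.
  by apply: pt_ind => [|j]; rewrite !ptE ?mevalN mevalXU ptE.
exists P, Q; split=> // [t z|t z|i]; last by rewrite mxE.
  by rewrite flowQ -flowD addNr flow0.
by rewrite flowQ -flowD addrN flow0.
Qed.

End FlowGroups.

End PolynomialFields.

From mathcomp Require Import all_classical all_reals all_analysis.

Import numFieldNormedType.Exports PolynomialFields.

Local Open Scope classical_set_scope.
Local Open Scope ring_scope.

(** * Analytic flows and conclusion *)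

Lemma is_derive_horner (K : numFieldType) (p : {poly K}) (t : K^o) :
  is_derive t (1 : K^o) (fun s : K^o => p.[s] : K^o) p^`().[t].
Proof.
elim/poly_ind: p => [|p c IH].
  have -> : (fun s : K^o => (0 : {poly K}).[s] : K^o) = cst 0.
    by apply/funext => s; rewrite horner0.
  by rewrite deriv0 horner0; exact: is_derive_cst.
have -> : (fun s : K^o => (p * 'X + c%:P).[s] : K^o) =
    (fun s : K^o => p.[s] : K^o) * id + cst c.
  by apply/funext => s; rewrite !hornerE.
apply: is_derive_eq; rewrite derivD derivM derivX derivC !hornerE addrC.
by congr (_ + _); [exact: mulrC | exact: mulr1].
Qed.

(** Along each orbit the flow of [triangular_flow] is a polynomial in time, so its formal derivative
    is the analytic one. *)
Lemma monomial_flow (K : numFieldType) n (V : vector_field K n) c M (rho : 'I_n -> nat) :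
  (forall i j, mpoly.fun_of_multinom (M i) j != 0%N -> (rho j < rho i)%N) ->
  (forall z i, V z ord0 i = mpoly.meval (z ord0) (monomial_field c M ord0 i)) ->
  exists phi, [/\ is_flow V phi, unipotent_subgroup phi &
    forall G : ('rV[K]_n -> 'rV[K]_n) -> Prop,
      (forall t, G (phi t)) -> tangent G (monomial_field c M)].
Proof.
move=> tri VE; have [P [P0 PD Pu PV]] := triangular_flow c tri.
exists (flow P); split; [|exact: flow_unipotent|move=> G GP]; last first.
  rewrite (_ : monomial_field c M = \row_i freeze 0 (mpoly.mderiv (lshift n ord0) (P i))).
    exact: flow_tangent.
  by apply/rowP => i; rewrite !mxE PV.
move=> z; split=> // t i; have [u uE] := Pu z.
have -> : (fun s : K^o => flow P s z ord0 i : K^o) = horner (u i).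
  by apply/funext => s; have [] := uE s i.
have [_ <-] : flow P t z ord0 i = (u i).[t] /\ (u i)^`().[t] = V (flow P t z) ord0 i.
  by have [-> ->] := uE t i; rewrite VE mxE.
exact: is_derive_horner.
Qed.



Theorem corollary11 (R : realType) (n : nat) (n_ge2 : (2 <= n)%N) :
  [/\ has_unipotent_flow (@fieldU R[i] n),
      has_unipotent_flow (@fieldV' R[i] n),
      has_unipotent_flow (@fieldV'' R[i] n)
    & infinitely_transitive
        (flow_group [set @fieldU R[i] n; @fieldV' R[i] n; @fieldV'' R[i] n])].
Proof.
set F := [set _; _; _]; pose C : numClosedFieldType := R[i].
have [phiU [flU uniU tanU]] : exists phi, [/\ is_flow (@fieldU C n) phi,
    unipotent_subgroup phi & forall G : ('rV[C]_n -> 'rV[C]_n) -> Prop,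
      (forall t, G (phi t)) -> tangent G
        (monomial_field (fun i => (i.+1 == n)%:R) (fun=> @mpoly.mnm0 n))].
  apply: (@monomial_flow C n _ _ _ (fun=> 0%N)) => [i j|z i].
    by rewrite mpoly.mnm0E.
  by rewrite fieldU_coord mxE.
have [phi' [fl' uni' tan']] : exists phi, [/\ is_flow (@fieldV' C n) phi,
    unipotent_subgroup phi & forall G : ('rV[C]_n -> 'rV[C]_n) -> Prop,
      (forall t, G (phi t)) -> tangent G (monomial_field (fun=> 1) (@expo' n))].
  (* Component [i] of V' involves only coordinates of larger index, so the rank decreases with the
     index; for V'' it is the opposite. *)
  apply: (@monomial_flow C n _ _ _ (fun i => n - i)%N) => [i j|z i].
    rewrite mpoly.mnmE => ij; apply: ltn_sub2l => //; move: ij.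
    by have [->//|_] := eqVneq (j : nat) i.+1; case: ltnP => // /ltnW.
  by rewrite fieldV'_coord mxE.
have [phi'' [fl'' uni'' tan'']] : exists phi, [/\ is_flow (@fieldV'' C n) phi,
    unipotent_subgroup phi & forall G : ('rV[C]_n -> 'rV[C]_n) -> Prop,
      (forall t, G (phi t)) -> tangent G (monomial_field (fun=> 1) (@expo'' n))].
  apply: (@monomial_flow C n _ _ _ (fun i => i : nat)) => [i j|z i].
    by rewrite mpoly.mnmE; have [<-//|_] := eqVneq j.+1 i; case: ltnP => // /ltnW.
  by rewrite fieldV''_coord mxE.
split; [by exists phiU | by exists phi' | by exists phi'' |].
(* [flow_group F] involves the time maps of all flows of the three fields;
   restricting to elements with an inverse in the group makes it unnecessary to
   know that flows are unique. *)
pose G g := flow_group F g /\ exists2 h, flow_group F h & cancel g h /\ cancel h g.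
have GV V phi : F V -> is_flow V phi -> unipotent_subgroup phi -> forall t, G (phi t).
  move=> FV Vphi [_ phi0 phiD] t.
  have FG s : flow_group F (phi s) by apply: gen_base; exists V => //; exists phi, s.
  split=> //; exists (phi (- t)) => //.
  by split=> z; rewrite -phiD ?addNr ?addrN phi0.
have Gext g h : g =1 h -> G g -> G h by move=> /funext ->.
have Gcomp g h : G g -> G h -> G (g \o h).
  move=> [Gg [g' Gg' [gK g'K]]] [Gh [h' Gh' [hK h'K]]]; split; first exact: gen_comp.
  by exists (h' \o g'); [exact: gen_comp | split; exact: can_comp].
have Gid : G id by split; [exact: gen_id | exists id => //; exact: gen_id].
have Ginv g h : G g -> cancel g h -> cancel h g -> G h.
  move=> [Gg _] gK hK; split; first exact: gen_inv Gg gK hK.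
  by exists g.
have Gbij g : G g -> exists2 h, G h & cancel g h.
  move=> Gg; have [_ [h _ [gK hK]]] := Gg.
  by exists h => //; exact: Ginv Gg gK hK.
move=> m x y xI yI.
suff [g [Gg _] gE] : exists2 g, G g & forall j, g (x j) = y j by exists g.
apply: transitive_points xI yI => //.
move=> p w wI i0 k.
apply: (@generators_span C n (tangent G)) => //.
- by move=> c Y; apply: tangentZ.
- by move=> Z Y; apply: tangent_bracket.
- move=> i ni; rewrite -(monomial_fieldU C ni).
  exact: tanU (GV _ _ (or_introl (or_introl erefl)) flU uniU).
- rewrite -monomial_field1.
  exact: tan' (GV _ _ (or_introl (or_intror erefl)) fl' uni').
- rewrite -monomial_field1.
  exact: tan'' (GV _ _ (or_intror erefl) fl'' uni'').
- by move=> Y Z; apply: tangentD.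
Qed.
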